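(* Let $G$ be a countable discrete amenable group, $X=\mathbb{N}^G$, let $\{E_m\}_m$ be an exhausting sequence of $G$, and let $c\colon G\times\mathbb{N}\to[0,\infty)$ be a function such that (1) $\sum_{m\geq1}|E_{m+1}\setminus E_m|\sum_{g\in G\setminus E_m}C(g)<\infty$, where $C(g)=\sup_{n\in\mathbb{N}}c(g,n)$ for $g\neq1_G$; and (2) for all $M>0$ there exists $n_0\in\mathbb{N}$ such that $M\log(n)\leq c(1_G,n)$ for all $n\geq n_0$. Let $\phi\colon X\to\mathbb{R}$ be given by $$\phi(x)=-\sum_{g\in G}c(g,x(1_G))\,\mathbf{1}_{\{x(1_G)=x(g)\}}.$$ If $$\beta\in\left(0,\ \frac{1}{4\sum_{h\in G,\,h\neq1_G}C(h)}\right)$$ (where $1/0$ is read as $+\infty$), then there exists exactly one DLR measure for $\beta\phi$.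
   Context: $\mathbb{N}$ is the set of non-negative integers; $\mathcal{F}(G)$ is the set of nonempty finite subsets of $G$. $G$ is amenable if for all $K\in\mathcal{F}(G)$, $\delta>0$ there is $F\in\mathcal{F}(G)$ with $|KF\,\triangle\,F|<\delta|F|$. $X=\mathbb{N}^G$ has the product topology and Borel $\sigma$-algebra $\mathcal{B}$; for $D\subseteq G$, $\mathcal{B}_D$ is the $\sigma$-algebra generated by the coordinates in $D$. For $w\in\mathbb{N}^K$, $wx_{K^c}$ is the configuration equal to $w$ on $K$ and to $x$ on $K^c=G\setminus K$. $G$ acts by $(g\cdot x)(h)=x(hg)$. For a potential $\psi\colon X\to\mathbb{R}$, $\psi_F(x)=\sum_{g\in F}\psi(g\cdot x)$. An exhausting sequence is a sequence $\{E_m\}_{m\ge0}$ of finite subsets of $G$ with $E_0=\emptyset$, $E_1=\{1_G\}$, strictly increasing, with union $G$. DLR measure for $\psi=\beta\phi$: for $K\in\mathcal{F}(G)$, $B\in\mathcal{B}$, $x\in X$ let $$\gamma_K(B,x)=\lim_{m\to\infty}\frac{\sum_{w\in\mathbb{N}^K}\exp(\psi_{E_m}(wx_{K^c}))\mathbf{1}_{\{wx_{K^c}\in B\}}}{\sum_{v\in\mathbb{N}^K}\exp(\psi_{E_m}(vx_{K^c}))}$$ (the limit exists under the present hypotheses). A Borel probability measure $\mu$ on $X$ is a DLR measure for $\psi$ if $\mu(B\,|\,\mathcal{B}_{K^c})(x)=\gamma_K(B,x)$ for $\mu$-a.e. $x$, for every $K\in\mathcal{F}(G)$, $B\in\mathcal{B}$.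 *)

(* Defs.v *)
From mathcomp Require Import all_boot all_order all_algebra finmap.
From mathcomp Require Import all_classical all_reals all_analysis.
From mathcomp Require Import measurable_realfun.

Set Implicit Arguments.
Unset Strict Implicit.
Unset Printing Implicit Defensive.

Import Order.TTheory GRing.Theory Num.Theory.
Import numFieldNormedType.Exports.

Local Open Scope classical_set_scope.
Local Open Scope ring_scope.

Definition amenable (R : realType) (G : groupType) : Prop :=
  forall (K : {fset G}) (delta : R), K != fset0 -> 0 < delta ->
  exists2 F : {fset G}, F != fset0 &
    let KF := [fset (k * f)%g | k in K, f in F]%fset in
    #|` ((KF `\` F) `|` (F `\` KF))%fset|%:R < delta * #|` F|%:R.

Definition exhausting (G : groupType) (E : nat -> {fset G}) : Prop :=
  [/\ E 0%N = fset0, E 1%N = [fset 1%g]%fset,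
      (forall m, (E m `<` E m.+1)%fset) &
      (forall g, exists m, g \in E m)].

(* Functions G -> nat with the product of the discrete topologies. *)
Definition config (G : groupType) := {ptws G -> nat}.

Definition borel_config (G : groupType) :=
  g_sigma_algebraType (@open (config G)).

(* The sigma-algebra generated by the coordinates in D. *)
Definition sigma_coord (G : groupType) (D : set G) : set (set (config G)) :=
  <<s \bigcup_(g in D)
        preimage_set_system setT (fun x : config G => x g) setT >>.

Definition act_config (G : groupType) (g : G) (x : config G) : config G :=
  fun h => x (h * g)%g.

(* The configuration equal to w on K and to x outside K. *)
Definition splice (G : groupType) (K : {fset G}) (w : {ffun K -> nat})
    (x : config G) : config G :=
  fun g => if insub g is Some k then w k else x g.

Definition psi_sum (R : realType) (G : groupType) (psi : config G -> R)
    (F : {fset G}) (x : config G) : R :=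
  \sum_(g <- F) psi (act_config g x).

(* The numerator and the denominator may be +oo for the finitely many m such
   that E m does not contain K. *)
Definition gibbs (R : realType) (G : groupType) (E : nat -> {fset G})
    (psi : config G -> R) (K : {fset G}) (B : set (config G))
    (x : config G) : \bar R :=
  limn (fun m =>
    ((\esum_(w in [set: {ffun K -> nat}])
        (expR (psi_sum psi (E m) (splice w x)) * \1_B (splice w x))%:E)
     / (\esum_(v in [set: {ffun K -> nat}])
        (expR (psi_sum psi (E m) (splice v x)))%:E))%E).

(* f is a version of the conditional probability mu(B | S). *)
Definition is_cond_prob (R : realType) (G : groupType)
    (mu : probability (borel_config G) R) (S : set (set (config G)))
    (B : set (config G)) (f : borel_config G -> \bar R) : Prop :=
  [/\ (forall Y : set (\bar R), measurable Y -> S (f @^-1` Y)),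
      mu.-integrable setT f &
      (forall A, S A -> (\int[mu]_(x in A) f x = mu (A `&` B))%E)].

Definition is_DLR (R : realType) (G : groupType) (E : nat -> {fset G})
    (psi : config G -> R) (mu : probability (borel_config G) R) : Prop :=
  forall (K : {fset G}) (B : set (borel_config G)),
  K != fset0 -> measurable B ->
  exists2 f : borel_config G -> \bar R,
    is_cond_prob mu (sigma_coord (~` [set` K])) B f &
    {ae mu, forall x, f x = gibbs E psi K B x}.

(* C(g); only used for g != 1. *)
Definition sup_c (R : realType) (G : groupType) (c : G -> nat -> R)
    (g : G) : \bar R :=
  ereal_sup (range (fun n => (c g n)%:E)).

(* The series, of nonnegative terms, is summed in \bar R; it converges under
   the summability assumption made on c. *)
Definition phi (R : realType) (G : groupType) (c : G -> nat -> R)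
    (x : config G) : R :=
  - fine (\esum_(g in [set: G])
            (c g (x 1%g) * (x 1%g == x g)%:R)%:E).

(* Main.v *)
From HB Require Import structures.
Require Import Defs.
From mathcomp Require Import all_boot all_order all_algebra finmap.
From mathcomp Require Import all_classical all_reals all_analysis.
From mathcomp Require Import measurable_realfun zify ring lra.

(** The energy is a pair interaction in which the sites [i] and [j] interact
    with strength at most [C (j i^-1) + C (i j^-1)], so changing the spin at [j]
    moves the single-site kernel at [i] by at most
    [2 beta (C (j i^-1) + C (i j^-1))] in total variation, and these influences
    sum to [4 beta \sum_h C h < 1] (Dobrushin's condition). Updating the sites
    one at a time then shows that the finite-volume averages of local functions
    become independent of the boundary condition as the volume grows, uniformly
    over all [0, 1]-valued functions of a given finite set of coordinates. This
    gives uniqueness at once. It also makes the finite-volume averages converge,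
    and the uniformity prevents any loss of mass in the limit although the spin
    space is infinite; a measure with the limiting cylinder masses is then built
    as the law of the digits of a uniform random number, and it satisfies the
    DLR equations because the kernels are quasi-local. *)

Set Implicit Arguments.
Unset Strict Implicit.
Unset Printing Implicit Defensive.

Import Order.TTheory GRing.Theory Num.Theory.
Import numFieldNormedType.Exports.

Local Open Scope classical_set_scope.
Local Open Scope ring_scope.

(** * Sums, and averages over configurations with a prescribed exterior *)

(** From the averages to the construction of the measure, only a kernel density [q] is used,
    evaluated at whole configurations, with three properties: mass 1 on each class, detailed
    balance, and a bound [(1 - theta K J) * q K y <= q K x]. The last replaces couplings and total
    variation: two boundary conditions share the portion [1 - theta] of the kernel. Sites near the
    edge of a finite volume never forget its exterior, so there is no contraction uniform over the
    volume. The decay is measured at a fixed finite set of sites while the volume grows, and the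
    exterior counts as one more site, whose coefficient stays 1. The constant 4 is 2 times 2: a
    change of spins moves the weight and the partition function, and a site is coupled to the others
    through its own values of [c] and through theirs. The growth of [c 1] serves to make
    [expR (- (beta * c 1 n))] summable. In [gibbs] the potential is summed over [E m], which only
    sees the pairs whose first site lies in [E m], whereas the energy of [K] contains every pair
    meeting [K]. The kernels must therefore be compared before the general theory applies. *)

Section esum_extra.
Variables (R : realType) (T : choiceType).
Implicit Types (A B : set T) (r : R) (a : T -> \bar R).

Lemma ge0_esumZl A r a : 0 <= r -> (forall i, (0 <= a i)%E) ->
  (\esum_(i in A) (r%:E * a i) = r%:E * \esum_(i in A) a i)%E.
Proof.
rewrite le_eqVlt => /predU1P[<- a0|].
  by rewrite mul0e esum1// => i Ai; rewrite mul0e.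
have le (s : R) (b : T -> \bar R) : 0 < s -> (forall i, (0 <= b i)%E) ->
    (\esum_(i in A) (s%:E * b i) <= s%:E * \esum_(i in A) b i)%E.
  move=> s0 b0; apply: ge_ereal_sup => _ [X [finX XA] <-].
  rewrite -ge0_mule_fsumr// lee_pmul2l ?lte_fin// ?ltry//.
  by apply: esum_ge; exists X.
move=> r0 a0; apply/eqP; rewrite eq_le le//=.
have ri : 0 < r^-1 by rewrite invr_gt0.
have := le _ (fun i => r%:E * a i)%E ri.
have -> : (\esum_(i in A) (r^-1%:E * (r%:E * a i)) = \esum_(i in A) a i)%E.
  by apply: eq_esum => i _; rewrite muleA -EFinM mulVf ?gt_eqF// mul1e.
move=> /(_ _)/wrap[]; first by move=> i; rewrite mule_ge0// lee_fin ltW.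
rewrite -(@lee_pmul2l _ r%:E) ?lte_fin// muleA -EFinM mulfV ?gt_eqF//.
by rewrite mul1e.
Qed.

Lemma sub_esum A B a : A `<=` B -> (forall i, (0 <= a i)%E) ->
  (\esum_(i in A) a i <= \esum_(i in B) a i)%E.
Proof.
move=> AB a0; apply: ge_ereal_sup => _ [X [finX XA] <-].
by apply: esum_ge; exists X => //; split=> //; apply: subset_trans AB.
Qed.

Lemma esumU A B a : A `&` B = set0 -> (forall i, (0 <= a i)%E) ->
  (\esum_(i in A `|` B) a i = \esum_(i in A) a i + \esum_(i in B) a i)%E.
Proof.
move=> AB a0; rewrite (esumID A)//; congr (_ + _)%E.
  by rewrite setIidr//; exact: subsetUl.
by rewrite -setDE setUKD// AB.
Qed.

Lemma esumU_le A B a : (forall i, (0 <= a i)%E) ->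
  (\esum_(i in A `|` B) a i <= \esum_(i in A) a i + \esum_(i in B) a i)%E.
Proof.
move=> a0; rewrite -(setDUK (@subsetUl _ A B)) esumU ?setDIK// leeD2l//.
by apply: sub_esum => // x [[]].
Qed.

Lemma esum_tail A a (e : R) : 0 < e -> (forall i, (0 <= a i)%E) ->
  (\esum_(i in A) a i < +oo)%E ->
  exists2 X : {fset T}, [set` X] `<=` A &
    (\esum_(i in A `\` [set` X]) a i <= e%:E)%E.
Proof.
move=> e0 a0 Aoo.
have Afin : \esum_(i in A) a i \is a fin_num.
  by rewrite ge0_fin_numE// esum_ge0.
have [_ [X [finX XA] <-] lX] := ub_ereal_sup_adherent e0 Afin.
exists (fset_set X); rewrite fset_setK//.
rewrite -/(esum A a) -esum_fset// in lX.
have AE := esumU (setDIK X A) a0; rewrite setDUK// in AE.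
rewrite {}AE in lX.
have Xfin : \esum_(i in X) a i \is a fin_num.
  rewrite ge0_fin_numE ?esum_ge0//; apply: le_lt_trans Aoo; exact: sub_esum.
have Dfin : \esum_(i in A `\` X) a i \is a fin_num.
  rewrite ge0_fin_numE ?esum_ge0//; apply: le_lt_trans Aoo.
  by apply: sub_esum => // x [].
move: lX Xfin Dfin; move: (esum X a) (esum (A `\` X) a) => [u| |] [v| |] //=.
by rewrite lte_fin lee_fin => + _ _; lra.
Qed.

Lemma ge0_sub_esum A B a b : A `<=` B -> (forall i, A i -> (a i <= b i)%E) ->
  (forall i, (0 <= b i)%E) ->
  (\esum_(i in A) a i <= \esum_(i in B) b i)%E.
Proof. by move=> AB ab b0; apply: le_trans (sub_esum AB b0); exact: le_esum. Qed.

End esum_extra.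

(** * Configurations that agree off a set *)

Section agreement.
Variable G : groupType.
Implicit Types (J : set G) (K : {fset G}) (x y z : config G).

Definition eq_off J x y := forall g, ~ J g -> x g = y g.

Lemma eq_off_refl J x : eq_off J x x. Proof. by []. Qed.

Lemma eq_off_sym J x y : eq_off J x y -> eq_off J y x.
Proof. by move=> xy g /xy. Qed.

Lemma eq_off_trans J y x z : eq_off J x y -> eq_off J y z -> eq_off J x z.
Proof. by move=> xy yz g Jg; rewrite xy// yz. Qed.

Lemma sub_eq_off J J' x y : J `<=` J' -> eq_off J x y -> eq_off J' x y.
Proof. by move=> JJ' xy g Jg; apply: xy => /JJ'. Qed.

Definition cls K x : set (config G) := [set y | eq_off [set` K] x y].

Lemma cls_refl K x : cls K x x. Proof. exact: eq_off_refl. Qed.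

Lemma eq_cls K x y : eq_off [set` K] x y -> cls K x = cls K y.
Proof.
move=> xy; apply/seteqP; split=> z /=; apply: eq_off_trans => //.
exact: eq_off_sym.
Qed.

Definition overlay K x y : config G := fun g => if g \in K then x g else y g.

Lemma overlay_cls K x y : cls K y (overlay K x y).
Proof. by move=> g /=; rewrite /overlay; case: ifP. Qed.

(** Carries a sum over one class to the class of another exterior, so that kernels with different
    boundary conditions can be compared term by term. *)
Lemma overlay_bij K x y : set_bij (cls K y) (cls K x) (fun z => overlay K z x).
Proof.
split=> [z _|u v|z]; first exact: overlay_cls.
- rewrite !inE => uy vy uv; apply: funext => g.
  have := congr1 (@^~ g) uv; rewrite /overlay.
  case: ifPn => // gK _; rewrite -uy ?vy//; exact/negP.
- move=> xz; exists (overlay K z y); first exact: overlay_cls.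
  apply: funext => g; rewrite /overlay; case: ifPn => [->//|gK].
  by rewrite xz//; exact/negP.
Qed.

Lemma eq_off_overlay J K x y z : eq_off J x y -> cls K y z ->
  eq_off J z (overlay K z x).
Proof.
move=> xy yz g Jg; rewrite /overlay; case: ifPn => // gK.
by rewrite xy// -yz//; exact/negP.
Qed.

End agreement.

(* A specification is given by [q]: the kernel of [K] with boundary condition [x]
   gives the mass [q K y] to every [y] in [cls K x]. *)
Section averages.
Variables (R : realType) (G : groupType) (q : {fset G} -> config G -> R).
Implicit Types (J : set G) (K L : {fset G}) (x y z : config G).
Implicit Types (f g : config G -> R).

Definition unit_valued f := forall x, 0 <= f x <= 1.

Definition gam K f x : R := fine (\esum_(y in cls K x) (q K y * f y)%:E).

Hypothesis q_ge0 : forall K x, 0 <= q K x.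
Hypothesis q_sum1 : forall K x, (\esum_(y in cls K x) (q K y)%:E = 1)%E.

Lemma qf_ge0 K f y : unit_valued f -> (0 <= (q K y * f y)%:E)%E.
Proof. by move=> f01; rewrite lee_fin mulr_ge0//; have /andP[] := f01 y. Qed.

Lemma esum_qZ K x r : 0 <= r -> (\esum_(y in cls K x) (q K y * r)%:E = r%:E)%E.
Proof.
move=> r0; under eq_esum do rewrite mulrC EFinM.
by rewrite ge0_esumZl// ?q_sum1 ?mule1// => i; rewrite lee_fin.
Qed.

Lemma gamE K f x : unit_valued f ->
  (gam K f x)%:E = \esum_(y in cls K x) (q K y * f y)%:E.
Proof.
move=> f01; rewrite fineK// ge0_fin_numE; last first.
  by apply: esum_ge0 => y _; exact: qf_ge0.
apply: le_lt_trans (ltry 1); rewrite -[leRHS](q_sum1 K x).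
apply: le_esum => y _; rewrite lee_fin ler_piMr//.
by have /andP[] := f01 y.
Qed.

Lemma gam_ler K f x r : unit_valued f -> (forall y, cls K x y -> f y <= r) ->
  gam K f x <= r.
Proof.
move=> f01 fr; have r0 : 0 <= r.
  by apply: le_trans (fr _ (@cls_refl _ K x)); have /andP[] := f01 x.
rewrite -lee_fin gamE// -(@esum_qZ K x r)//; apply: le_esum => y /fr fry.
by rewrite lee_fin ler_wpM2l.
Qed.

Lemma gam_ger K f x r : unit_valued f -> (forall y, cls K x y -> r <= f y) ->
  r <= gam K f x.
Proof.
move=> f01 fr; rewrite -lee_fin gamE//; have [r0|/ltW r0] := leP 0 r.
  rewrite -(@esum_qZ K x r)//; apply: le_esum => y /fr fry.
  by rewrite lee_fin ler_wpM2l.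
apply: (@le_trans _ _ 0%E); first by rewrite lee_fin.
by apply: esum_ge0 => y _; exact: qf_ge0.
Qed.

Lemma gam_unit K f : unit_valued f -> unit_valued (gam K f).
Proof.
move=> f01 x; rewrite gam_ger ?gam_ler// => y _;
  by have /andP[] := f01 y.
Qed.

Lemma gam_eq_cls K f x y : eq_off [set` K] x y -> gam K f x = gam K f y.
Proof. by move=> xy; rewrite /gam (eq_cls xy). Qed.

Lemma gamD K f g x : unit_valued f -> unit_valued g ->
  unit_valued (fun y => f y + g y) ->
  gam K (fun y => f y + g y) x = gam K f x + gam K g x.
Proof.
move=> f01 g01 fg01; apply: EFin_inj; rewrite EFinD !gamE// -esumD; last 2 first.
- by move=> y _; exact: qf_ge0.
- by move=> y _; exact: qf_ge0.
by apply: eq_esum => y _; rewrite -EFinD mulrDr.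
Qed.

(** The kernel is proper: a factor that ignores the spins in [K] is constant on the class. This
    later lets exterior events pass through the kernel. *)
Lemma gam_properM K f g x : unit_valued f -> unit_valued g ->
  (forall y, cls K x y -> f y = f x) ->
  gam K (fun y => f y * g y) x = f x * gam K g x.
Proof.
move=> f01 g01 fx; have /andP[fx0 fx1] := f01 x.
apply: EFin_inj; rewrite EFinM !gamE//; last first.
  move=> y; have /andP[? ?] := f01 y; have /andP[? ?] := g01 y.
  by rewrite mulr_ge0//= mulr_ile1.
rewrite -ge0_esumZl//; last by move=> i; exact: qf_ge0.
by apply: eq_esum => y /fx ->; rewrite -EFinM mulrCA.
Qed.

Section consistency.
Hypothesis q_bal : forall K L x y, (K `<=` L)%fset -> eq_off [set` K] x y ->
  q L x * q K y = q L y * q K x.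

(* Detailed balance: exchange the two summation variables. *)
Lemma gam_gam K L f x : (K `<=` L)%fset -> unit_valued f ->
  gam L (gam K f) x = gam L f x.
Proof.
move=> KL f01; apply: EFin_inj; rewrite !gamE//; last exact: gam_unit.
have KL' : [set` K] `<=` [set` L] by move=> g /= /(fsubsetP KL).
transitivity (\esum_(y in cls L x) \esum_(z in cls K y)
    (q L y * (q K z * f z))%:E).
  apply: eq_esum => y _; rewrite EFinM gamE// -ge0_esumZl//.
  by move=> z; exact: qf_ge0.
have qqf_ge0 y z : (0 <= (q L y * (q K z * f z))%:E)%E.
  by rewrite lee_fin mulr_ge0//; have := @qf_ge0 K f z f01; rewrite lee_fin.
rewrite esum_esum// [LHS](reindex_esum (cls L x `*`` cls K) _
   (fun yz => (yz.2, yz.1))); last first.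
  split=> [[y z] [xy yz]|[y z] [y' z'] _ _ [-> ->]//|[y z] [/= xy yz]] /=.
  - split=> /=; last exact: eq_off_sym.
    exact: eq_off_trans xy (sub_eq_off KL' yz).
  - exists (z, y) => //; split=> /=; last exact: eq_off_sym.
    exact: eq_off_trans xy (sub_eq_off KL' yz).
transitivity (\esum_(y in cls L x) \esum_(z in cls K y)
    (q L y * f y * q K z)%:E).
  rewrite esum_esum; last first.
    by move=> y z _ _; rewrite lee_fin !mulr_ge0//; have /andP[] := f01 y.
  apply: eq_esum => -[y z] [/= xy yz].
  by rewrite mulrA -(q_bal KL yz) mulrAC.
apply: eq_esum => y _; under eq_esum do rewrite EFinM.
rewrite ge0_esumZl ?q_sum1 ?mule1//; first by have := @qf_ge0 L f y f01.
by move=> z; rewrite lee_fin.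
Qed.

End consistency.

Section sensitivity.
Variable theta : {fset G} -> set G -> R.
Hypothesis theta_ge0 : forall K J, 0 <= theta K J.
Hypothesis q_sens : forall K J x y, (forall i, i \in K -> ~ J i) ->
  eq_off J x y -> (1 - theta K J) * q K y <= q K x.

(** Two effects add up: [f] itself sees the change on [J], at cost [dJ], and the kernel moves at
    most a share [theta K J] of its mass, inside a class where [f] varies by at most [dK]. *)
Lemma gam_sens K J f x y dK dJ : unit_valued f ->
  (forall i, i \in K -> ~ J i) -> eq_off J x y -> 0 <= dK -> 0 <= dJ ->
  (forall u v, eq_off [set` K] u v -> `|f u - f v| <= dK) ->
  (forall u v, eq_off J u v -> `|f u - f v| <= dJ) ->
  `|gam K f x - gam K f y| <= dJ + theta K J * dK.
Proof.
move=> f01 KJ xy dK0 dJ0 fK fJ.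
suff le u v : eq_off J u v ->
    gam K f u <= gam K f v + (dJ + theta K J * dK).
  rewrite ler_norml; have := le _ _ xy; have := le _ _ (eq_off_sym xy); lra.
move=> {xy} uv; move: u v uv => {}x {}y xy.
(* Only [f - m], which is nonnegative and at most [dK], feels the change of
   kernel. *)
pose m := inf (f @` cls K y).
have mf z : cls K y z -> m <= f z.
  move=> yz; apply: ge_inf; last by exists z.
  by exists 0 => _ [u _ <-]; have /andP[] := f01 u.
have m0 : 0 <= m.
  apply: lb_le_inf; first by exists (f y), y => //; exact: cls_refl.
  by move=> _ [u _ <-]; have /andP[] := f01 u.
have fm z : cls K y z -> f z <= m + dK.
  move=> yz; rewrite -lerBlDr; apply: lb_le_inf.
    by exists (f y), y => //; exact: cls_refl.
  move=> _ [u yu <-]; have := fK z u; rewrite ler_norml => /(_ _)/wrap[].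
    exact: eq_off_trans (eq_off_sym yz) yu.
  lra.
have r0 : 0 <= theta K J * dK + m + dJ by rewrite !addr_ge0// mulr_ge0.
rewrite -lee_fin gamE// (reindex_esum _ _ _ _ (overlay_bij K x y)).
(* Write [f z = (f z - m) + m]. For the first part, the share [1 - theta] of the kernel at [x] is
   dominated by the kernel at [y], and the rest costs [theta * dK]. The absolute value only makes
   the term nonnegative off the class too. *)
have termwise z : cls K y z -> ((q K (overlay K z x) * f (overlay K z x))%:E <=
    (q K z * `|f z - m|)%:E +
    (q K (overlay K z x) * (theta K J * dK + m + dJ))%:E)%E.
  move=> yz; rewrite -EFinD lee_fin ger0_norm ?subr_ge0 ?mf//.
  have zz := eq_off_overlay xy yz; have := q_sens KJ zz.
  have := mf z yz; have := fm z yz; have := fJ _ _ zz.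
  have := q_ge0 K z; have := q_ge0 K (overlay K z x).
  have := theta_ge0 K J; rewrite ler_norml.
  move: (q K z) (q K (overlay K z x)) (f z) (f (overlay K z x)) (theta K J).
  move=> a b c d t t0 b0 a0 /andP[cd _] c1 c2 ab.
  have h1 : b * d <= b * (c + dJ) by rewrite ler_wpM2l//; lra.
  have h2 : (1 - t) * b * (c - m) <= a * (c - m) by rewrite ler_wpM2r//; lra.
  have h3 : t * b * (c - m) <= t * b * dK by rewrite ler_wpM2l ?mulr_ge0//; lra.
  nra.
apply: (le_trans (le_esum termwise)).
rewrite esumD; last 2 first.
- by move=> z _; rewrite lee_fin mulr_ge0.
- by move=> z _; rewrite lee_fin mulr_ge0.
have -> : (\esum_(z in cls K y) (q K (overlay K z x) *
    (theta K J * dK + m + dJ))%:E = (theta K J * dK + m + dJ)%:E)%E.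
  by rewrite -(reindex_esum _ _ _
    (fun z => (q K z * (theta K J * dK + m + dJ))%:E) (overlay_bij K x y)) esum_qZ.
suff : (\esum_(z in cls K y) (q K z * `|f z - m|)%:E + m%:E <=
    (gam K f y)%:E)%E.
  move=> le; rewrite (EFinD (gam K f y)).
  have -> : (theta K J * dK + m + dJ)%:E =
     (m%:E + (dJ + theta K J * dK)%:E)%E by rewrite -EFinD; congr EFin; lra.
  by rewrite addeA leeD2r.
rewrite gamE// -(@esum_qZ K y m)// -esumD; last 2 first.
- by move=> z _; rewrite lee_fin mulr_ge0.
- by move=> z _; rewrite lee_fin mulr_ge0.
apply: le_esum => z yz; rewrite -EFinD lee_fin ger0_norm ?subr_ge0 ?mf//.
lra.
Qed.

End sensitivity.

End averages.

(** * Dobrushin's estimate *)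

Lemma fset_eventually_all (T : choiceType) (I : choiceType)
    (P : I -> {fset T} -> Prop) (F : {fset I}) :
  (forall i, i \in F -> exists S, forall L, (S `<=` L)%fset -> P i L) ->
  exists S, forall L, (S `<=` L)%fset -> forall i, i \in F -> P i L.
Proof.
move=> h; have /choice[S hS] : forall i, exists S,
    i \in F -> forall L, (S `<=` L)%fset -> P i L.
  move=> i; have [iF|iF] := boolP (i \in F); last by exists fset0.
  by have [S hS] := h i iF; exists S.
exists (\bigcup_(i <- F) S i)%fset => L SL i iF.
by apply: hS => //; apply: fsubset_trans SL; exact: bigfcup_sup.
Qed.

Section dobrushin.
Variables (R : realType) (G : groupType) (q : {fset G} -> config G -> R).
Implicit Types (J : set G) (K L S : {fset G}) (x y z : config G) (i j : G).
Implicit Types (f : config G -> R) (a : G -> R).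

Local Notation gam := (gam q).

Definition osc J (d : R) f := forall x y, eq_off J x y -> `|f x - f y| <= d.

Definition local_on L f :=
  forall x y, (forall i, i \in L -> x i = y i) -> f x = f y.

Hypothesis q_ge0 : forall K x, 0 <= q K x.
Hypothesis q_sum1 : forall K x, (\esum_(y in cls K x) (q K y)%:E = 1)%E.
Hypothesis q_bal : forall K L x y, (K `<=` L)%fset -> eq_off [set` K] x y ->
  q L x * q K y = q L y * q K x.

Variable theta : {fset G} -> set G -> R.
Hypothesis theta_ge0 : forall K J, 0 <= theta K J.
Hypothesis q_sens : forall K J x y, (forall i, i \in K -> ~ J i) ->
  eq_off J x y -> (1 - theta K J) * q K y <= q K x.
Hypothesis theta_split : forall i S L, i \in S -> (S `<=` L)%fset ->
  \sum_(j <- (L `\` S)%fset) theta [fset i]%fset [set j] +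
    theta [fset i]%fset (~` [set` L]) <= theta [fset i]%fset (~` [set` S]).
Variable r : R.
Hypothesis r_lt1 : r < 1.
Hypothesis theta_row : forall i,
  theta [fset i]%fset (~` [set` [fset i]%fset]) <= r.
Hypothesis theta_tail : forall K (e : R), 0 < e ->
  exists S, forall L, (S `<=` L)%fset -> theta K (~` [set` L]) <= e.

Local Notation tht i := (theta [fset i]%fset).

(* [a] is a Dobrushin estimate in [L]: the exterior of [L] counts as one more
   site, of coefficient 1. *)
Definition estimate L a := forall f (delta : G -> R) (d : R),
  unit_valued f -> (forall j, 0 <= delta j) -> 0 <= d ->
  (forall j, j \in L -> osc [set j] (delta j) f) -> osc (~` [set` L]) d f ->
  forall x y,
    `|gam L f x - gam L f y| <= \sum_(j <- L) a j * delta j + d.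

Lemma osc_seq (s : seq G) (delta : G -> R) f :
  (forall j, j \in s -> osc [set j] (delta j) f) ->
  osc [set` s] (\sum_(j <- s) delta j) f.
Proof.
elim: s => [|j s ih] h x y xy.
  rewrite big_nil (_ : x = y) ?subrr ?normr0//.
  by apply: funext => g; exact: xy.
pose z : config G := fun g => if g == j then y g else x g.
rewrite big_cons (le_trans (ler_distD (f z) _ _))// lerD//.
  apply: h; first exact: mem_head.
  by move=> g gj; rewrite /z; case: eqP gj => // ->.
apply: ih; first by move=> k ks; apply: h; rewrite inE ks orbT.
move=> g gs; rewrite /z; case: eqP => // /eqP gj; apply: xy.
by rewrite /= inE (negPf gj).
Qed.

(** Starting point of the sweeps. Any two values of [f], hence any two averages, are this close: go
    from [u] to [v] through the configuration equal to [u] on [L] and to [v] outside. *)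
Lemma estimate1 L : estimate L (fun=> 1).
Proof.
move=> f delta d f01 delta0 d0 fL fLc.
set D := _ + d; suff fuv u v : f u <= f v + D.
  move=> x y; rewrite ler_norml.
  have le u v : gam L f u <= gam L f v + D.
    rewrite -lerBlDr; apply: gam_ger => // z _; rewrite lerBlDr.
    by apply: gam_ler => // w _.
  have := le x y; have := le y x; lra.
have /= := osc_seq fL; rewrite -/(osc _ _ _) => fS.
pose w := overlay L u v.
have /fLc : eq_off (~` [set` L]) w u.
  by move=> g /= /contrapT gL; rewrite /w /overlay gL.
have /fS : eq_off [set` L] w v.
  by move=> g /= /negP gL; rewrite /w /overlay (negPf gL).
have -> : \sum_(j <- L) delta j = D - d.
  by rewrite /D addrK; apply: eq_bigr => j _; rewrite mul1r.
rewrite !ler_norml; lra.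
Qed.

Lemma estimate_le L a b : (forall j, j \in L -> a j <= b j) ->
  estimate L a -> estimate L b.
Proof.
move=> ab ea f delta d f01 delta0 d0 fL fLc x y.
apply: le_trans (ea f delta d f01 delta0 d0 fL fLc x y) _.
rewrite lerD2r big_seq [leRHS]big_seq; apply: ler_sum => j jL.
by rewrite ler_wpM2r// ab.
Qed.

(** Row [i] of Dobrushin's influence matrix applied to [a], the exterior of [L] entering with
    coefficient 1. *)
Definition site_update L a i : R :=
  \sum_(j <- (L `\ i)%fset) tht i [set j] * a j + tht i (~` [set` L]).

Lemma osc_gam1 i f J (dJ di : R) : unit_valued f -> ~ J i ->
  0 <= di -> 0 <= dJ -> osc [set i] di f -> osc J dJ f ->
  osc J (dJ + tht i J * di) (gam [fset i]%fset f).
Proof.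
move=> f01 Ji di0 dJ0 fi fJ x y xy; apply: gam_sens => //.
- by move=> k; rewrite inE => /eqP ->.
- move=> u v uv; apply: fi => g gi; apply: uv => /=; rewrite inE.
  by move=> /eqP.
Qed.

(** By consistency [f] may be replaced by its average over the spin at [i]. This kills the
    oscillation at [i] and adds [theta_i(j) * delta i] to the one at [j]. Reading the old estimate
    with these oscillations and collecting the terms in [delta i] gives the new coefficient at
    [i]. *)
Lemma estimate_update L a i : i \in L -> estimate L a ->
  estimate L (fun j => if j == i then site_update L a i else a j).
Proof.
move=> iL ea f delta d f01 delta0 d0 fL fLc x y.
have iLs : ([fset i] `<=` L)%fset by rewrite fsub1set.
rewrite -!(gam_gam q_ge0 q_sum1 q_bal _ iLs f01).
pose delta' j := if j == i then 0 else delta j + tht i [set j] * delta i.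
have := ea (gam [fset i]%fset f) delta' (d + tht i (~` [set` L]) * delta i).
move=> /(_ _ _ _ _ _ x y)/wrap[].
- exact: gam_unit.
- by move=> j; rewrite /delta'; case: ifP => // _; rewrite addr_ge0// mulr_ge0.
- by rewrite addr_ge0// mulr_ge0.
- move=> j jL; rewrite /delta'; case: eqVneq => [->|ji].
    move=> u v uv; rewrite (@gam_eq_cls _ _ _ _ _ u v) ?subrr ?normr0//.
    by move=> g /= gi; apply: uv => /= gi'; apply: gi; rewrite gi' inE.
  apply: osc_gam1 => //; [|exact: fL|exact: fL].
  by move=> /= ij; rewrite ij eqxx in ji.
- by apply: osc_gam1 => //; exact: fL.
move=> le; apply: le_trans le _.
rewrite (big_fsetD1 i iL)/= /delta' eqxx mulr0 add0r.
rewrite [leRHS](_ : _ = \sum_(j <- (L `\ i)%fset) (a j * delta j) +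
  site_update L a i * delta i + d); last first.
  rewrite (big_fsetD1 i iL)/= eqxx; congr (_ + _); rewrite addrC; congr (_ + _).
  rewrite big_seq [RHS]big_seq; apply: eq_bigr => j.
  by rewrite !inE => /andP[/negPf ->].
rewrite (_ : \sum_(j <- _) _ = \sum_(j <- (L `\ i)%fset) (a j * delta j) +
  (\sum_(j <- (L `\ i)%fset) tht i [set j] * a j) * delta i).
  by rewrite le_eqVlt; apply/orP; left; apply/eqP; rewrite /site_update; ring.
rewrite mulr_suml -big_split/= big_seq [RHS]big_seq; apply: eq_bigr => j.
by rewrite !inE => /andP[/negPf -> _]; ring.
Qed.

(* [n] sweeps of updates over all the sites of [L]. *)
Fixpoint alpha L n : G -> R :=
  if n is n'.+1 then site_update L (alpha L n') else fun=> 1.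

Lemma site_update_le L a b i : i \in L ->
  (forall j, j \in L -> a j <= b j) -> site_update L a i <= site_update L b i.
Proof.
move=> iL ab; rewrite lerD2r big_seq [leRHS]big_seq; apply: ler_sum => j.
by rewrite !inE => /andP[_ jL]; rewrite ler_wpM2l// ab.
Qed.

(** For [n = 0] this is the row condition, reached through [theta_split] with [S = {i}]; afterwards
    the update is monotone. *)
Lemma alpha_decr L n i : i \in L -> alpha L n.+1 i <= alpha L n i.
Proof.
elim: n i => [|n ih] i iL; last exact: site_update_le.
rewrite /= /site_update; under eq_bigr do rewrite mulr1.
have iLs : ([fset i] `<=` L)%fset by rewrite fsub1set.
exact: le_trans (theta_split (fset11 i) iLs) (le_trans (theta_row i) (ltW r_lt1)).
Qed.

Lemma alpha_le1 L n i : i \in L -> alpha L n i <= 1.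
Proof.
by move=> iL; elim: n => [//|n]; apply: le_trans; exact: alpha_decr.
Qed.

(** [alpha] updates all sites at once from the old coefficients, while [estimate_update] treats one
    site at a time. As the coefficients decrease, the successive updates only meet smaller ones, so
    [alpha] remains an upper bound; the invariant [a <= alpha L n] on all of [L] records this. *)
Lemma estimate_alpha L n : estimate L (alpha L n).
Proof.
elim: n => [|n ih]; first exact: estimate1.
suff [a [ea _ an]] : exists a, [/\ estimate L a,
    forall j, j \in L -> a j <= alpha L n j &
    forall j, j \in enum_fset L -> a j <= alpha L n.+1 j].
  exact: estimate_le ea.
have : {subset enum_fset L <= L} by [].
elim: (enum_fset L) => [_|i s ihs isL]; first by exists (alpha L n).
have [|a [ea aL as_]] := ihs; first by move=> j js; apply: isL; rewrite inE js orbT.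
have iL : i \in L by apply: isL; exact: mem_head.
exists (fun j => if j == i then site_update L a i else a j); split.
- exact: estimate_update.
- move=> j jL; case: eqVneq => [->|_]; last exact: aL.
  by apply: le_trans (alpha_decr _ _); rewrite //= site_update_le.
- move=> j; rewrite inE; case: eqVneq => [-> _|_ /= js]; last exact: as_.
  exact: site_update_le.
Qed.

Lemma row_ge0 : 0 <= r.
Proof. exact: le_trans (theta_row 1%g). Qed.

(** Induction on [n], with [L] large depending on [i], [n] and [e]. Beyond a finite set [S1] the
    influence on [i] is at most [e / 2] and the coefficients are bounded by 1; on [S1] the induction
    hypothesis applies at finitely many sites and gains the factor [r]. *)
Lemma alpha_small n i (e : R) : 0 < e ->
  exists S, forall L, (S `<=` L)%fset -> alpha L n i <= r ^+ n + e.
Proof.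
elim: n i e => [|n ih] i e e0.
  by exists fset0 => L _; rewrite expr0 lerDl ltW.
have e20 : 0 < e / 2 by rewrite divr_gt0.
have [S0 hS0] := theta_tail [fset i]%fset e20.
pose S1 := (i |` S0)%fset.
have [S hS] := fset_eventually_all (F := S1) (fun j _ => ih j _ e20).
exists (S1 `|` S)%fset => L; rewrite fsubUset => /andP[S1L /hS {}hS] /=.
have iS1 : i \in S1 by rewrite !inE eqxx.
have iL := fsubsetP S1L i iS1.
have S1i : ([fset i] `<=` S1)%fset by rewrite fsub1set.
rewrite /site_update (big_fsetID _ (fun j => j \in S1))/=.
set A := (X in X + _ + _); set B := (X in _ + X + _).
have hA : A <= r * (r ^+ n + e / 2).
  rewrite {}/A; apply: (@le_trans _ _ ((\sum_(j <- (S1 `\` [fset i])%fset)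
      tht i [set j]) * (r ^+ n + e / 2))); last first.
    rewrite ler_wpM2r//; last first.
      apply: le_trans (theta_row i); apply: le_trans (theta_split (fset11 i) S1i).
      by rewrite lerDl.
    by rewrite addr_ge0 ?exprn_ge0 ?row_ge0// ltW.
  rewrite mulr_suml.
  rewrite (_ : [fset x in (L `\ i)%fset | x \in S1]%fset = (S1 `\` [fset i])%fset).
    rewrite big_seq [leRHS]big_seq; apply: ler_sum => j; rewrite !inE.
    move=> /andP[ji jS]; rewrite ler_wpM2l// hS//.
    by rewrite !inE.
  apply/fsetP => j; rewrite !inE /=.
  have [->|ji] //= := eqVneq j i.
  case: (boolP (j \in S0)) => [jS0|]; rewrite ?andbF//= andbT.
  by apply: (fsubsetP S1L); rewrite !inE jS0 orbT.
(* The far sites of [L] and the exterior of [L] are disjoint parts of the complement of [S1], so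
   [theta_split] bounds both by a single tail. *)
have hB : B + tht i (~` [set` L]) <= e / 2.
  apply: le_trans (hS0 S1 (fsubsetUr _ _)).
  apply: le_trans (theta_split iS1 S1L); rewrite lerD2r {}/B.
  rewrite (_ : [fset x in (L `\ i)%fset | x \notin S1]%fset = (L `\` S1)%fset).
    rewrite big_seq [leRHS]big_seq; apply: ler_sum => j; rewrite !inE.
    by move=> /andP[_ jL]; rewrite ler_piMr// alpha_le1.
  apply/fsetP => j; rewrite !inE /=.
  by have [->|ji] //= := eqVneq j i; rewrite andbC.
have := row_ge0; rewrite exprS; move: hA hB.
rewrite -addrA; move: (B + _) A => b a' ha hb r0.
have : r * (e / 2) <= e / 2 by rewrite ler_piMl// ltW.
lra.
Qed.

(** The function enters only through oscillations at most 1 on [F] and 0 elsewhere, the exterior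
    included since [F] lies in [L]; hence [S] does not depend on [f]. The [+ 1] in [N] covers an
    empty [F]. *)
Theorem gam_boundary_decay F (e : R) : 0 < e ->
  exists S, forall L, (S `<=` L)%fset -> forall f, unit_valued f ->
    local_on F f -> forall x y, `|gam L f x - gam L f y| <= e.
Proof.
move=> e0; pose N : R := #|` F|%:R + 1.
have N0 : 0 < N by rewrite ltr_wpDl.
have e'0 : 0 < e / N / 2 by rewrite !divr_gt0.
have [n hn] : exists n, r ^+ n <= e / N / 2.
  have : (r ^+ n) @[n --> \oo] --> (0 : R).
    by apply: cvg_expr; rewrite ger0_norm// row_ge0.
  move=> /cvgr0Pnorm_le/(_ _ e'0)[n _ /(_ n (leqnn n)) /= h].
  by exists n; apply: le_trans h; exact: ler_norm.
have [S hS] := fset_eventually_all (F := F) (fun j _ => alpha_small n j e'0).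
exists (F `|` S)%fset => L; rewrite fsubUset => /andP[FL /hS {}hS] f f01 fF x y.
have := @estimate_alpha L n f (fun j => (j \in F)%:R) 0 f01.
move=> /(_ _ _ _ _ x y)/wrap[] //.
- move=> j jL u v uv; case: (boolP (j \in F)) => jF.
    have /andP[? ?] := f01 u; have /andP[? ?] := f01 v.
    rewrite ler_norml /=; lra.
  rewrite (fF u v) ?subrr ?normr0// => k kF; apply: uv => /= kj.
  by rewrite -kj kF in jF.
- move=> u v uv; rewrite (fF u v) ?subrr ?normr0// => k kF; apply: uv => /=.
  by move=> /(_ (fsubsetP FL k kF)).
move=> le; apply: le_trans le _; rewrite addr0.
rewrite (big_fsetID _ (fun j => j \in F))/= [X in _ + X]big1_seq ?addr0; last first.
  by move=> j /= ; rewrite !inE => /andP[_ /negPf ->]; rewrite mulr0.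
rewrite (_ : [fset x in L | x \in F]%fset = F); last first.
  apply/fsetP => j; rewrite !inE /=; case: (boolP (j \in F)) => //= jF.
    by rewrite (fsubsetP FL).
  by rewrite andbF.
apply: (@le_trans _ _ (\sum_(j <- F) (e / N))).
  rewrite big_seq [leRHS]big_seq; apply: ler_sum => j jF.
  rewrite jF mulr1; have := hS j jF; lra.
rewrite big_const_seq count_predT iter_addr addr0 -mulr_natr.
rewrite mulrAC ler_pdivrMr// ler_wpM2l// ?ltW//; rewrite /N; lra.
Qed.

End dobrushin.

(** * Probability measures with prescribed cylinder masses *)

Section unit_interval_measure.
Variable R : realType.

Definition unit_interval_measure : set (measurableTypeR R) -> \bar R :=
  mrestr lebesgue_measure (measurable_itv `[(0 : R), 1[).

HB.instance Definition _ := Measure.on unit_interval_measure.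

Lemma unit_interval_measure_setT : unit_interval_measure setT = 1%E.
Proof.
rewrite /unit_interval_measure/= /mrestr/= setTI lebesgue_measure_itv/=.
by rewrite lte_fin ltr01 oppr0 adde0.
Qed.

HB.instance Definition _ := Measure_isProbability.Build _ _ _
  unit_interval_measure unit_interval_measure_setT.

End unit_interval_measure.

(* Words list the values of a sequence in reverse order: the head of [w] is
   the value at [size w - 1]. *)
Fixpoint matches (w : seq nat) (y : nat -> nat) : Prop :=
  if w is k :: w' then y (size w') = k /\ matches w' y else True.

Section interval_splitting.
Variables (R : realType) (P : seq nat -> R).
Hypothesis P_ge0 : forall w, 0 <= P w.
Hypothesis P_nil : P [::] = 1.
Hypothesis P_split : forall w,
  (fun n => \sum_(k < n) P (val k :: w)) @ \oo --> P w.

(* The word [w] is coded by an interval of length [P w], which is cut into the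
   intervals of the words [k :: w]; the digits of [u] are those of the words
   whose intervals contain [u]. *)
Fixpoint left_end (w : seq nat) : R :=
  if w is k :: w' then left_end w' + \sum_(j < k) P (val j :: w') else 0.

(** Half-open, so that the intervals of the words [k :: w] are disjoint and exactly cover that of
    [w], and a word of mass 0 gets an empty interval. *)
Definition word_itv w : set R := [set` `[left_end w, left_end w + P w[].

Lemma partial_P_le w n : \sum_(k < n) P (val k :: w) <= P w.
Proof.
rewrite -(cvg_lim (@Rhausdorff R) (@P_split w)).
apply: (@nondecreasing_cvgn_le _ (fun n => \sum_(k < n) P (val k :: w)));
  last by apply: cvgP; exact: P_split.
by apply/nondecreasing_seqP => m; rewrite big_ord_recr/= lerDl.
Qed.

Lemma word_itv_sub k w : word_itv (k :: w) `<=` word_itv w.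
Proof.
move=> u; rewrite /word_itv /= !in_itv/= => /andP[lu ur].
have := partial_P_le w k.+1; rewrite big_ord_recr/= => le.
have s0 : 0 <= \sum_(j < k) P (val j :: w) by apply: sumr_ge0.
lra.
Qed.

(** As [u] is strictly below the right end, some partial sum of the masses passes it; the letter is
    the predecessor of the least such number of terms. *)
Lemma word_itv_split u w : word_itv w u -> exists k, word_itv (k :: w) u.
Proof.
rewrite /word_itv /= in_itv/= => /andP[lu ur].
have ex : exists n, u - left_end w < \sum_(k < n) P (val k :: w).
  have : u - left_end w < P w by lra.
  move=> /(cvgr_gt _ (@P_split w))[n _ /(_ n (leqnn n))] h.
  by exists n.
case: (ex_minnP ex) => -[|m]; first by rewrite big_ord0 => h _; lra.
rewrite big_ord_recr/= => h hmin; exists m; rewrite in_itv/=.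
have := hmin m; case: leP => [|_ /(_ isT)]; last by rewrite ltnn.
lra.
Qed.

Lemma word_itv_inj u w k l :
  word_itv (k :: w) u -> word_itv (l :: w) u -> k = l.
Proof.
wlog kl : k l / (k < l)%N.
  move=> h ku lu; have [kl|lk|//] := ltngtP k l.
    exact: (h _ _ kl).
  by apply/esym; exact: (h _ _ lk).
rewrite /word_itv /= !in_itv/= => /andP[_ ku] /andP[lu _].
suff : \sum_(j < k) P (val j :: w) + P (k :: w) <= \sum_(j < l) P (val j :: w).
  by move=> le; exfalso; lra.
rewrite (_ : _ + _ = \sum_(j < k.+1) P (val j :: w)); last first.
  by rewrite big_ord_recr.
rewrite -!(big_mkord xpredT (fun j => P (j :: w))) [leRHS](big_cat_nat _ kl)//=.
by rewrite lerDl; apply: sumr_ge0.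
Qed.

Definition next_letter u w : nat := xget 0%N [set k | word_itv (k :: w) u].

Lemma next_letterP u w k :
  word_itv (k :: w) u -> word_itv (next_letter u w :: w) u.
Proof.
by move=> ku; apply: (@xgetI _ 0%N [set k | word_itv (k :: w) u] k ku).
Qed.

Fixpoint word_at u n : seq nat :=
  if n is n'.+1 then next_letter u (word_at u n') :: word_at u n' else [::].

Definition itv_digits u n : nat := next_letter u (word_at u n).

Lemma size_word_at u n : size (word_at u n) = n.
Proof. by elim: n => //= n ->. Qed.

Lemma matches_word_at u w : matches w (itv_digits u) <-> word_at u (size w) = w.
Proof.
elim: w => [//|k w ih] /=; split=> [[<- /ih e]|[ek e]].
  by rewrite /itv_digits e.
by split; [rewrite -ek|apply/ih].
Qed.

Lemma word_itv01 w : word_itv w `<=` [set` `[(0 : R), 1[].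
Proof.
elim: w => [|k w]; first by rewrite /word_itv /= P_nil add0r.
by apply: subset_trans; exact: word_itv_sub.
Qed.

Lemma word_itv_word_at u n : u \in `[(0 : R), 1[ -> word_itv (word_at u n) u.
Proof.
move=> u01; elim: n => [|n ih] /=; first by rewrite /word_itv /= P_nil add0r.
by have [k ku] := word_itv_split ih; exact: next_letterP ku.
Qed.

Lemma word_at_word_itv u w : word_itv w u -> word_at u (size w) = w.
Proof.
elim: w => [//|k w ih] ku /=; have wu := word_itv_sub ku.
rewrite (ih wu); congr (_ :: _); apply: (@word_itv_inj u w _ k) => //.
exact: next_letterP ku.
Qed.

Lemma matches_digits w :
  [set u | matches w (itv_digits u)] `&` [set` `[(0 : R), 1[] = word_itv w.
Proof.
apply/seteqP; split=> [u [/= /matches_word_at wu u01]|u wu].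
  by rewrite -wu; exact: word_itv_word_at.
by split; [apply/matches_word_at/word_at_word_itv|exact: word_itv01 wu].
Qed.

Lemma measurable_digit n k :
  measurable ([set u | itv_digits u n = k] : set (measurableTypeR R)).
Proof.
pose U := [set` `[(0 : R), 1[].
rewrite (_ : [set _ | _] =
    (\bigcup_(w in [set w | size w = n]) word_itv (k :: w)) `|`
    (~` U `&` [set u | 0%N = k])).
  apply: measurableU.
    rewrite (_ : \bigcup_(w in _) _ = \bigcup_w
      (if size w == n then word_itv (k :: w) else set0)).
      apply: countable_bigcupT_measurable => // w.
      by case: ifP => // _; exact: measurable_itv.
    apply/seteqP; split => [u [w /= wn wu]|u [w _]].
      by exists w => //; rewrite wn eqxx.
    by case: eqP => // wn wu; exists w.
  apply: measurableI; first by apply: measurableC; exact: measurable_itv.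
  have [k0|k0] := pselect (0%N = k).
    by rewrite (_ : [set _ | _] = setT)//; apply/seteqP; split.
  by rewrite (_ : [set _ | _] = set0)//; apply/seteqP; split.
(* Outside the unit interval no word interval contains [u], and [xget] returns its default 0. *)
have out u : ~ U u -> itv_digits u n = 0%N.
  move=> Uu; rewrite /itv_digits /next_letter; case: xgetP => // l _ lu.
  by exfalso; apply: Uu; exact: word_itv01 lu.
apply/seteqP; split=> [u /= uk|u [[w /= wn wu]|[/= Uu <-]]]; last exact: out.
  have [u01|u01] := pselect (U u); last by right; split => //=; rewrite -uk out.
  left; exists (word_at u n); first exact: size_word_at.
  by rewrite -uk; exact: (@word_itv_word_at u n.+1).
have := word_at_word_itv wu; rewrite /= wn => -[]; rewrite /itv_digits.
by move=> ->.
Qed.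

Lemma unit_interval_matches w :
  unit_interval_measure [set u : R | matches w (itv_digits u)] = (P w)%:E.
Proof.
rewrite /unit_interval_measure /mrestr/= matches_digits lebesgue_measure_itv/=.
rewrite lte_fin ltrDl; case: ltP => [_|Pw].
  by rewrite -EFinB addrAC subrr add0r.
by apply/eqP; rewrite eq_sym eqe eq_le Pw P_ge0.
Qed.

End interval_splitting.

(** * Limits of finite-volume averages *)

Section infinite_volume_limit.
Variables (R : realType) (G : groupType) (q : {fset G} -> config G -> R).
Implicit Types (J : set G) (K L S F : {fset G}) (x y z : config G) (i j : G).
Implicit Types (f g : config G -> R).

Local Notation gam := (gam q).

Hypothesis q_ge0 : forall K x, 0 <= q K x.
Hypothesis q_sum1 : forall K x, (\esum_(y in cls K x) (q K y)%:E = 1)%E.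
Hypothesis q_bal : forall K L x y, (K `<=` L)%fset -> eq_off [set` K] x y ->
  q L x * q K y = q L y * q K x.
Hypothesis decay : forall F (e : R), 0 < e ->
  exists S, forall L, (S `<=` L)%fset -> forall f, unit_valued f ->
    local_on F f -> forall x y, `|gam L f x - gam L f y| <= e.
Variable E : nat -> {fset G}.
Hypothesis E_mono : forall m n, (m <= n)%N -> (E m `<=` E n)%fset.
Hypothesis E_cover : forall S, exists n, (S `<=` E n)%fset.

Let x0 : config G := fun=> 0%N.

Definition quasi_local f := forall e : R, 0 < e ->
  exists F, forall x y, (forall i, i \in F -> x i = y i) -> `|f x - f y| <= e.

Definition lim_gam f : R := limn (fun n => gam (E n) f x0).

Lemma local_quasi_local F f : local_on F f -> quasi_local f.
Proof.
move=> fF e e0; exists F => x y /fF ->.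
by rewrite subrr normr0 ltW.
Qed.

Lemma gam_close L f g (e : R) x : unit_valued f -> unit_valued g -> 0 <= e ->
  (forall y, `|f y - g y| <= e) -> `|gam L f x - gam L g x| <= e.
Proof.
move=> f01 g01 e0 fg.
have le u v : unit_valued u -> unit_valued v -> (forall y, u y <= v y + e) ->
    gam L u x <= gam L v x + e.
  move=> u01 v01 uv; rewrite -lee_fin EFinD !gamE//.
  rewrite -(@esum_qZ _ _ _ q_ge0 q_sum1 L x e)// -esumD; last 2 first.
  - by move=> y _; exact: qf_ge0.
  - by move=> y _; rewrite lee_fin mulr_ge0.
  apply: le_esum => y _; rewrite -EFinD lee_fin -mulrDr ler_wpM2l//; exact: uv.
have fgy y : f y <= g y + e by have := fg y; rewrite ler_norml; lra.
have gfy y : g y <= f y + e by have := fg y; rewrite ler_norml; lra.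
have := le _ _ f01 g01 fgy; have := le _ _ g01 f01 gfy.
rewrite ler_norml; lra.
Qed.

Section family.
Variable Fam : (config G -> R) -> Prop.
Hypothesis Fam_unit : forall f, Fam f -> unit_valued f.
Hypothesis Fam_decay : forall e : R, 0 < e -> exists n0, forall n, (n0 <= n)%N ->
  forall f, Fam f -> forall x y, `|gam (E n) f x - gam (E n) f y| <= e.

(** By consistency the average in [E m] is an average of values of [gam (E n) f], which all lie
    within [e] of one another. A family is used so that one proof serves all functions of given
    coordinates, with a common rate, and a single quasi-local function. *)
Lemma family_cauchy (e : R) : 0 < e -> exists n0, forall n m, (n0 <= n <= m)%N ->
  forall f, Fam f -> forall x y, `|gam (E n) f x - gam (E m) f y| <= e.
Proof.
move=> e0; have [n0 h] := Fam_decay e0; exists n0 => n m /andP[n0n nm] f Ff x y.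
rewrite -(gam_gam q_ge0 q_sum1 q_bal y (E_mono nm) (Fam_unit Ff)).
have g01 : unit_valued (gam (E n) f).
  by apply: gam_unit => //; exact: Fam_unit.
have lo : gam (E n) f x - e <= gam (E m) (gam (E n) f) y.
  apply: gam_ger => // z _; have := h n n0n f Ff x z; rewrite ler_norml; lra.
have hi : gam (E m) (gam (E n) f) y <= gam (E n) f x + e.
  apply: gam_ler => // z _; have := h n n0n f Ff x z; rewrite ler_norml; lra.
rewrite ler_norml; lra.
Qed.

Lemma family_cvg f : Fam f -> cvgn (fun n => gam (E n) f x0).
Proof.
move=> Ff; apply: cauchy_cvg; apply: cauchy_exP => e e0.
have e20 : 0 < e / 2 by rewrite divr_gt0.
have [n0 h] := family_cauchy e20; exists (gam (E n0) f x0).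
exists n0 => // m /= n0m; apply: (le_lt_trans (h n0 m _ f Ff x0 x0)).
  by rewrite leqnn.
lra.
Qed.

Lemma family_lim (e : R) : 0 < e -> exists n0, forall n, (n0 <= n)%N ->
  forall f, Fam f -> forall x, `|gam (E n) f x - lim_gam f| <= e.
Proof.
move=> e0; have [n0 h] := family_cauchy e0; exists n0 => n n0n f Ff x.
have c := family_cvg Ff.
have hm m : (n <= m)%N -> `|gam (E n) f x - gam (E m) f x0| <= e.
  by move=> nm; apply: h => //; rewrite n0n.
rewrite ler_norml; apply/andP; split.
  suff : lim_gam f <= gam (E n) f x + e by lra.
  apply: limr_le => //; exists n => // m /= /hm; rewrite ler_norml; lra.
suff : gam (E n) f x - e <= lim_gam f by lra.
apply: limr_ge => //; exists n => // m /= /hm; rewrite ler_norml; lra.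
Qed.

End family.

Lemma local_lim F (e : R) : 0 < e -> exists n0, forall n, (n0 <= n)%N ->
  forall f, unit_valued f -> local_on F f -> forall x,
  `|gam (E n) f x - lim_gam f| <= e.
Proof.
move=> e0.
have [|d d0|n0 h] := @family_lim (fun f => unit_valued f /\ local_on F f) _ _ e e0.
- by move=> f [].
- have [S hS] := decay F d0; have [n0 Sn0] := E_cover S.
  exists n0 => n n0n f [f01 fF] x y; apply: hS => //.
  exact: fsubset_trans Sn0 (E_mono n0n).
- by exists n0 => n n0n f f01 fF x; apply: h.
Qed.

(** Freezing the coordinates outside [F] to 0 gives a local [h] within [e / 3] of [f]; the three
    thirds are two replacements of [f] by [h] and the decay for [h]. The form [g = f] fits the
    one-element family. *)
Lemma quasi_local_decay f : unit_valued f -> quasi_local f ->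
  forall e : R, 0 < e -> exists n0, forall n, (n0 <= n)%N ->
  forall g, g = f -> forall x y, `|gam (E n) g x - gam (E n) g y| <= e.
Proof.
move=> f01 fq e e0; have e30 : 0 < e / 3 by rewrite divr_gt0.
have [F hF] := fq _ e30; pose h : config G -> R := fun x => f (overlay F x x0).
have h01 : unit_valued h by move=> x; exact: f01.
have hl : local_on F h.
  move=> x y xy; rewrite /h; congr f; apply: funext => i; rewrite /overlay.
  by case: ifPn => // /xy.
have fh x : `|f x - h x| <= e / 3.
  by apply: hF => i iF; rewrite /overlay iF.
have [S hS] := decay F e30; have [n0 Sn0] := E_cover S.
exists n0 => n n0n g -> x y.
have := hS (E n) (fsubset_trans Sn0 (E_mono n0n)) h h01 hl x y.
have := gam_close (E n) x f01 h01 (ltW e30) fh.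
have := gam_close (E n) y f01 h01 (ltW e30) fh.
rewrite !ler_norml; lra.
Qed.

Lemma quasi_local_lim f (e : R) : unit_valued f -> quasi_local f -> 0 < e ->
  exists n0, forall n, (n0 <= n)%N -> forall x,
  `|gam (E n) f x - lim_gam f| <= e.
Proof.
move=> f01 fq e0.
have [|n0 h] := @family_lim (fun g => g = f) _ (quasi_local_decay f01 fq) e e0.
  by move=> g ->.
by exists n0 => n n0n x; apply: h.
Qed.

Lemma gam_cvg f : unit_valued f -> quasi_local f ->
  gam (E n) f x0 @[n --> \oo] --> lim_gam f.
Proof.
move=> f01 fq; apply: (@family_cvg (fun g => g = f)) => //.
  by move=> g ->.
exact: quasi_local_decay.
Qed.

Lemma lim_gam_unique f l : gam (E n) f x0 @[n --> \oo] --> l -> lim_gam f = l.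
Proof. by move=> fl; apply: cvg_lim fl; exact: Rhausdorff. Qed.

Lemma lim_gam_ge0 f : unit_valued f -> quasi_local f -> 0 <= lim_gam f.
Proof.
move=> f01 fq; apply: limr_ge; first by apply: cvgP; exact: gam_cvg.
by apply: nearW => n; have /andP[] := gam_unit q_ge0 q_sum1 (E n) f01 x0.
Qed.

Lemma lim_gam_le1 f : unit_valued f -> quasi_local f -> lim_gam f <= 1.
Proof.
move=> f01 fq; apply: limr_le; first by apply: cvgP; exact: gam_cvg.
by apply: nearW => n; have /andP[] := gam_unit q_ge0 q_sum1 (E n) f01 x0.
Qed.

Lemma lim_gamD f g : unit_valued f -> quasi_local f ->
  unit_valued g -> quasi_local g -> unit_valued (fun x => f x + g x) ->
  lim_gam (fun x => f x + g x) = lim_gam f + lim_gam g.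
Proof.
move=> f01 fq g01 gq fg01; apply: lim_gam_unique.
rewrite (_ : (fun n => _) = (fun n => gam (E n) f x0 + gam (E n) g x0)).
  by apply: cvgD; exact: gam_cvg.
by apply: funext => n; exact: gamD.
Qed.

Lemma unit_valued_cst (r : R) : 0 <= r <= 1 -> unit_valued (fun _ : config G => r).
Proof. by move=> r01 x. Qed.

Lemma lim_gam_cst (r : R) : 0 <= r <= 1 -> lim_gam (fun _ : config G => r) = r.
Proof.
move=> r01; apply: lim_gam_unique.
rewrite (_ : (fun n => _) = (fun=> r)); first exact: cvg_cst.
apply: funext => n; apply/eqP; rewrite eq_le gam_ler ?gam_ger//;
  exact: unit_valued_cst.
Qed.

Lemma lim_gam_properZ (r : R) f : 0 <= r <= 1 -> unit_valued f ->
  quasi_local f -> lim_gam (fun x => r * f x) = r * lim_gam f.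
Proof.
move=> r01 f01 fq; apply: lim_gam_unique.
rewrite (_ : (fun n => _) = (fun n => r * gam (E n) f x0)).
  by apply: cvgM; [exact: cvg_cst|exact: gam_cvg].
apply: funext => n; apply: (@gam_properM _ _ q _ _ _ (fun=> r)) => //.
Qed.

Lemma lim_gam_close f g (e : R) : unit_valued f -> quasi_local f ->
  unit_valued g -> quasi_local g -> 0 <= e ->
  (forall x, `|f x - g x| <= e) -> `|lim_gam f - lim_gam g| <= e.
Proof.
move=> f01 fq g01 gq e0 fg.
have c : (`|gam (E n) f x0 - gam (E n) g x0|) @[n --> \oo] -->
    `|lim_gam f - lim_gam g|.
  by apply: cvg_norm; apply: cvgB; exact: gam_cvg.
rewrite -(cvg_lim (@Rhausdorff R) c); apply: limr_le; first exact: cvgP c.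
by apply: nearW => n; exact: gam_close.
Qed.

Lemma lim_gam_gam K f : unit_valued f -> quasi_local f ->
  lim_gam (gam K f) = lim_gam f.
Proof.
move=> f01 fq; apply: lim_gam_unique; have [n0 Kn0] := E_cover K.
apply: cvg_trans (gam_cvg f01 fq); apply: near_eq_cvg.
exists n0 => // n /= n0n; rewrite gam_gam//.
exact: fsubset_trans Kn0 (E_mono n0n).
Qed.

(** Finitely many configurations carry all but [e] of the mass; take [n] above their values at
    [i]. *)
Lemma gam_tail K x i (e : R) : 0 < e -> exists n0, forall n, (n0 <= n)%N ->
  gam K (fun y => (n <= y i)%:R) x <= e.
Proof.
move=> e0.
have [||X Xcls hX] := @esum_tail _ _ (cls K x) (fun y => (q K y)%:E) e e0.
- by move=> y; rewrite lee_fin.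
- by rewrite q_sum1 ltry.
exists (\max_(y <- X) y i).+1 => n nX; rewrite -lee_fin gamE//; last first.
  by move=> y; rewrite ler0n lern1 leq_b1.
apply: le_trans hX; rewrite (esumID [set` X])//; last first.
  by move=> y _; rewrite lee_fin mulr_ge0.
rewrite esum1 ?add0e; last first.
  move=> y [_ /= yX]; rewrite leqNgt (leq_trans _ nX) ?mulr0//.
  by rewrite ltnS; apply: leq_bigmax_seq.
apply: le_esum => y _; rewrite lee_fin ler_piMr// lern1 leq_b1 //.
Qed.

Definition truncated f i k : config G -> R := fun x => f x * (x i == k)%:R.

Lemma unit_valuedM f g : unit_valued f -> unit_valued g ->
  unit_valued (fun x => f x * g x).
Proof.
move=> f01 g01 x; have /andP[? ?] := f01 x; have /andP[? ?] := g01 x.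
by rewrite mulr_ge0//= mulr_ile1.
Qed.

Lemma unit_valued_bool (b : config G -> bool) :
  unit_valued (fun x => (b x)%:R : R).
Proof. by move=> x; rewrite ler0n lern1 leq_b1. Qed.

(** Tightness of one coordinate. The events [n <= x i] all depend on the coordinate [i] alone, so a
    single volume [E m0] approximates their limits for every [n] at once, and there the tail is
    small. *)
Lemma lim_gam_tail i (e : R) : 0 < e -> exists n0, forall n, (n0 <= n)%N ->
  lim_gam (fun x => (n <= x i)%:R) <= e.
Proof.
move=> e0; have e20 : 0 < e / 2 by rewrite divr_gt0.
have [m0 hm] := @local_lim [fset i]%fset _ e20.
have [n0 hn] := @gam_tail (E m0) x0 i _ e20; exists n0 => n n0n.
have := hn n n0n.
have := hm m0 (leqnn _) (fun x => (n <= x i)%:R) (unit_valued_bool _) _ x0.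
rewrite ler_norml => /(_ _)/wrap[]; last by lra.
by move=> x y xy; rewrite xy// inE.
Qed.

Lemma local_truncated F f i (b : nat -> bool) : local_on F f ->
  local_on (i |` F)%fset (fun x => f x * (b (x i))%:R).
Proof.
move=> fF x y xy; rewrite (xy i) ?inE ?eqxx// (fF x y)// => j jF.
by apply: xy; rewrite !inE jF orbT.
Qed.

(** Linearity gives the finite sums; what is left is the part of [f] where [x i] is at least [n],
    dominated by the tail just bounded. No mass escapes to infinity. *)
Lemma lim_gam_split F f i : unit_valued f -> local_on F f ->
  \sum_(k < n) lim_gam (truncated f i k) @[n --> \oo] --> lim_gam f.
Proof.
move=> f01 fF.
have fq := local_quasi_local fF.
pose lo n : config G -> R := fun x => f x * (x i < n)%:R.
pose hi n : config G -> R := fun x => f x * (n <= x i)%:R.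
have lo01 n : unit_valued (lo n).
  by apply: unit_valuedM => //; exact: unit_valued_bool.
have hi01 n : unit_valued (hi n).
  by apply: unit_valuedM => //; exact: unit_valued_bool.
have tr01 k : unit_valued (truncated f i k).
  by apply: unit_valuedM => //; exact: unit_valued_bool.
have loq n : quasi_local (lo n).
  exact: (local_quasi_local (@local_truncated _ _ i (fun k => k < n)%N fF)).
have hiq n : quasi_local (hi n).
  exact: (local_quasi_local (@local_truncated _ _ i (fun k => n <= k)%N fF)).
have trq k : quasi_local (truncated f i k).
  exact: (local_quasi_local (@local_truncated _ _ i (fun l => l == k) fF)).
have sumE n : \sum_(k < n) lim_gam (truncated f i k) = lim_gam (lo n).
  elim: n => [|n ih].
    rewrite big_ord0 -[LHS](@lim_gam_cst 0) ?lexx ?ler01//.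
    by congr lim_gam; apply: funext => x; rewrite /lo mulr0.
  have loS : lo n.+1 = (fun x => lo n x + truncated f i n x).
    apply: funext => x; rewrite /lo /truncated -mulrDr -natrD ltnS leq_eqVlt.
    by case: ltngtP.
  by rewrite big_ord_recr/= ih loS lim_gamD// -loS.
have flohi n : f = (fun x => lo n x + hi n x).
  apply: funext => x; rewrite /lo /hi -mulrDr -natrD.
  by case: ltnP; rewrite ?mulr1.
apply/cvgrPdist_le => e e0; have [n0 hn] := @lim_gam_tail i e e0.
exists n0 => // n /= /hn h; rewrite sumE [in X in X - _](flohi n).
rewrite lim_gamD//; last by rewrite -flohi.
rewrite addrC addKr ger0_norm; last exact: lim_gam_ge0.
apply: le_trans h.
have tq : quasi_local (fun x => (n <= x i)%:R).
  apply: (@local_quasi_local [fset i]%fset) => x y xy.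
  by rewrite xy// inE.
have cq : quasi_local (fun x => (1 - f x) * (n <= x i)%:R).
  apply: local_quasi_local.
  apply: (@local_truncated F (fun x => 1 - f x) i (fun k => n <= k)%N).
  by move=> x y /fF ->.
have c01 : unit_valued (fun x => (1 - f x) * (n <= x i)%:R).
  apply: unit_valuedM; last exact: unit_valued_bool.
  by move=> x; have := f01 x; lra.
(* Monotonicity of [lim_gam] is obtained from additivity, by writing the tail indicator as [hi n]
   plus a nonnegative remainder. *)
rewrite [leRHS](_ : _ = lim_gam (fun x => hi n x + (1 - f x) * (n <= x i)%:R)).
  rewrite lim_gamD// ?lerDl ?lim_gam_ge0// => x.
  rewrite /hi -mulrDl addrCA subrr addr0 mul1r.
  exact: (unit_valued_bool (fun x => n <= x i)%N x).
congr lim_gam; apply: funext => x.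
by rewrite /hi -mulrDl addrCA subrr addr0 mul1r.
Qed.

End infinite_volume_limit.

(** * Borel sets of configurations *)

Fixpoint word_of (y : nat -> nat) n : seq nat :=
  if n is n'.+1 then y n' :: word_of y n' else [::].

Lemma size_word_of y n : size (word_of y n) = n.
Proof. by elim: n => //= n ->. Qed.

Lemma matches_word_of y n y' :
  matches (word_of y n) y' <-> forall i, (i < n)%N -> y' i = y i.
Proof.
elim: n => [|n ih] //=; rewrite size_word_of; split.
  by move=> [yn /ih h] i; rewrite ltnS leq_eqVlt => /predU1P[->|/h].
by move=> h; split; [exact: h|apply/ih => i /ltnW; exact: h].
Qed.

Lemma matchesE w y : matches w y <-> word_of y (size w) = w.
Proof.
elim: w => [//|k w ih] /=; split=> [[<- /ih ->]//|[ek e]].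
by split=> //; apply/ih.
Qed.

Section borel_config_theory.
Variable G : groupType.
Implicit Types (x y : config G).

Lemma measurable_coord (i : G) (A : set nat) :
  measurable ([set x | A (x i)] : set (borel_config G)).
Proof.
apply: sub_sigma_algebra; apply: open_comp; last exact: (discrete_open A).
by move=> x _; exact: (@proj_continuous _ (fun _ : G => nat : topologicalType)).
Qed.

Variables (site : nat -> G) (idx : G -> nat).
Hypothesis siteK : cancel idx site.

Definition Cyl w : set (borel_config G) :=
  [set x : config G | matches w (fun n => x (site n))].

Lemma measurable_Cyl w : measurable (Cyl w).
Proof.
elim: w => [|k w ih]; first exact: measurableT.
by apply: measurableI ih; exact: (@measurable_coord (site (size w)) [set k]).
Qed.

Lemma CylP x n y : Cyl (word_of (fun n => x (site n)) n) y <->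
  forall i, (i < n)%N -> y (site i) = x (site i).
Proof. exact: matches_word_of. Qed.

(** Otherwise each cylinder around [x] contains some [y n] outside [O]; these converge
    coordinatewise to [x], against the openness of [O]. *)
Lemma open_Cyl (O : set (config G)) x : open O -> O x ->
  exists n, Cyl (word_of (fun n => x (site n)) n) `<=` O.
Proof.
move=> oO Ox; apply: contrapT => /forallNP h.
have /choice[y hy] : forall n, exists y : config G,
    Cyl (word_of (fun n => x (site n)) n) y /\ ~ O y.
  by move=> n; have /existsNP[y /not_implyP] := h n; exists y.
have yx : y @ \oo --> x.
  apply/cvg_sup => i A /= [_ [[B oB <-] Bx] BA].
  (* A cylinder of length [n] fixes the sites of index below [n], so [i] is fixed as soon as [n]
     exceeds [idx i]. *)
  exists (idx i).+1 => // n /= idxn; apply: BA => /=.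
  have [/CylP /(_ _ idxn) + _] := hy n.
  by rewrite siteK => ->.
have nO : nbhs x O by apply: open_nbhs_nbhs.
have [N _ /(_ N (leqnn N))] := yx _ nO.
by case: (hy N).
Qed.

(** There are countably many words, so an open set is a countable union of the cylinders it
    contains. *)
Lemma borel_config_Cyl :
  (measurable : set (set (borel_config G))) = <<s range Cyl >>.
Proof.
apply/seteqP; split; last first.
  apply: smallest_sub; first exact: sigma_algebra_measurable.
  by move=> _ [w _ <-]; exact: measurable_Cyl.
apply: smallest_sub; first exact: smallest_sigma_algebra.
move=> O oO.
pose T := g_sigma_algebraType (range Cyl).
rewrite (_ : O = \bigcup_w (if `[< Cyl w `<=` O >] then Cyl w else set0)).
  apply: (@countable_bigcupT_measurable _ T) => // w.
  by case: ifP => // _; apply: sub_sigma_algebra; exists w.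
apply/seteqP; split => [x Ox|x [w _]]; last first.
  by case: ifPn => // /asboolP; apply.
have [n nO] := open_Cyl oO Ox; exists (word_of (fun n => x (site n)) n) => //.
by case: asboolP => // _; apply/CylP.
Qed.

(** Two cylinders that meet come from words one of which extends the other, so the longer one is
    their intersection; [set0] is added for those that do not meet. *)
Lemma setI_closed_Cyl : setI_closed (set0 |` range Cyl).
Proof.
have I0 (A : set (borel_config G)) : A `&` set0 = set0 by rewrite setI0.
move=> A B [->|[w _ <-]]; first by rewrite set0I; left.
move=> [->|[w' _ <-]]; first by rewrite setI0; left.
wlog ww' : w w' / (size w <= size w')%N.
  by move=> h; case: (leqP (size w) (size w')) => [/h //|/ltnW/h]; rewrite setIC.
have [[x [xw xw']]|no] := pselect (exists x, Cyl w x /\ Cyl w' x); last first.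
  by left; apply/seteqP; split => // x [xw xw']; apply: no; exists x.
right; exists w' => //; apply/esym/setIidr => y /matchesE yw'.
have /matchesE {}xw := xw; have /matchesE {}xw' := xw'.
rewrite -xw; apply/CylP => i iw; rewrite -yw' in xw'.
have : matches (word_of (fun n => y (site n)) (size w'))
   (fun n => x (site n)).
  by rewrite -xw'; apply/matchesE; rewrite size_word_of.
move=> /matches_word_of/(_ i (leq_trans iw ww')).
by [].
Qed.

Lemma borel_config_unique (R : realType)
    (m1 m2 : {measure set (borel_config G) -> \bar R}) :
  (forall w, m1 (Cyl w) = m2 (Cyl w)) -> (m1 setT < +oo)%E ->
  forall B, measurable B -> m1 B = m2 B.
Proof.
move=> m12 m1T; apply: (@measure_unique _ _ _ (set0 |` range Cyl) (fun=> setT)).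
- rewrite borel_config_Cyl; apply/seteqP; split.
    by apply: sub_smallest2r; [exact: smallest_sigma_algebra|right].
  apply: smallest_sub; first exact: smallest_sigma_algebra.
  move=> A [->|Aw]; last exact: sub_sigma_algebra.
  by case: (@smallest_sigma_algebra _ setT (range Cyl)).
- exact: setI_closed_Cyl.
- by move=> i; right; exists [::].
- by rewrite bigcup_const.
- by move=> A [->|[w _ <-]]; rewrite ?measure0.
- by move=> k.
Qed.

End borel_config_theory.

(** * The limit measure and the DLR equations *)

Lemma splice_bij (G : groupType) (K : {fset G}) (x : config G) :
  set_bij [set: {ffun K -> nat}] (cls K x) (fun w => splice w x).
Proof.
split=> [w _ g /= gK|v w _ _ vw|y xy].
- by rewrite /splice insubF//; exact/negP.
- apply/ffunP => k; have := congr1 (@^~ (val k)) vw.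
  by rewrite /splice /= !valK.
- exists [ffun k => y (val k)] => //; apply: funext => g.
  rewrite /splice; case: insubP => [k gK <-|gK]; first by rewrite ffunE.
  by rewrite xy//; exact/negP.
Qed.

(** The sum becomes a series over the codes of the index type, with zero terms at the numbers that
    code nothing. *)
Lemma emeasurable_esum d (T : measurableType d) (R : realType) (I : countType)
    (h : I -> T -> \bar R) :
  (forall i x, (0 <= h i x)%E) -> (forall i, measurable_fun setT (h i)) ->
  measurable_fun setT (fun x => \esum_(i in [set: I]) h i x).
Proof.
move=> h0 mh.
pose a x n := if @pickle_inv I n is Some i then h i x else 0%E.
have a0 x n : (0 <= a x n)%E by rewrite /a; case: pickle_inv.
have E x : \esum_(i in [set: I]) h i x = (\sum_(n <oo) a x n)%E.
  rewrite nneseries_esumT// [RHS](esumID (range (@choice.pickle I)))// !setTI.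
  rewrite [X in (_ + X)%E]esum1 ?adde0.
    rewrite esum_image; last by move=> i j _ _; exact: (pcan_inj choice.pickleK).
    by apply: eq_esum => i _; rewrite /a pickleK_inv.
  move=> n /= nI; rewrite /a; case: pickle_inv (@pickle_invK I n) => //= i iE.
  by exfalso; apply: nI; exists i.
under eq_fun do rewrite E.
apply: (ge0_emeasurable_sum (P := xpredT)) => // n _; rewrite /a.
by case: pickle_inv => [i|]; [exact: mh|exact: measurable_cst].
Qed.

Section dobrushin_measure.
Variables (R : realType) (G : groupType) (q : {fset G} -> config G -> R).
Implicit Types (J : set G) (K L S F : {fset G}) (x y z : config G).
Implicit Types (f : config G -> R).

Local Notation gam := (gam q).

Hypothesis q_ge0 : forall K x, 0 <= q K x.
Hypothesis q_sum1 : forall K x, (\esum_(y in cls K x) (q K y)%:E = 1)%E.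
Hypothesis q_bal : forall K L x y, (K `<=` L)%fset -> eq_off [set` K] x y ->
  q L x * q K y = q L y * q K x.
Variable theta : {fset G} -> set G -> R.
Hypothesis theta_ge0 : forall K J, 0 <= theta K J.
Hypothesis q_sens : forall K J x y, (forall i, i \in K -> ~ J i) ->
  eq_off J x y -> (1 - theta K J) * q K y <= q K x.
Hypothesis theta_tail : forall K (e : R), 0 < e ->
  exists S, forall L, (S `<=` L)%fset -> theta K (~` [set` L]) <= e.
Hypothesis decay : forall F (e : R), 0 < e ->
  exists S, forall L, (S `<=` L)%fset -> forall f, unit_valued f ->
    local_on F f -> forall x y, `|gam L f x - gam L f y| <= e.
Variable E : nat -> {fset G}.
Hypothesis E_mono : forall m n, (m <= n)%N -> (E m `<=` E n)%fset.
Hypothesis E_cover : forall S, exists n, (S `<=` E n)%fset.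
Variables (site : nat -> G) (idx : G -> nat).
Hypothesis siteK : cancel idx site.
Hypothesis idxK : cancel site idx.

Local Notation Cyl := (Cyl site).
Local Notation lim_gam := (lim_gam q E).
Let x0 : config G := fun=> 0%N.

Lemma unit_valued_indic (A : set (config G)) :
  unit_valued (\1_A : config G -> R).
Proof. by move=> x; rewrite indicE ler0n lern1 leq_b1. Qed.

Definition initially_local n f := forall x y,
  (forall k, (k < n)%N -> x (site k) = y (site k)) -> f x = f y.

Definition sites n : {fset G} := [fset i in [seq site k | k <- iota 0 n]]%fset.

Lemma sites_mem k n : (k < n)%N -> site k \in sites n.
Proof. by move=> kn; rewrite inE; apply: map_f; rewrite mem_iota. Qed.

Lemma initially_local_on n f : initially_local n f -> local_on (sites n) f.
Proof. by move=> fn x y xy; apply: fn => k kn; apply: xy; exact: sites_mem. Qed.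

Lemma local_on_initially F f : local_on F f -> exists n, initially_local n f.
Proof.
move=> fF; exists (\max_(i <- F) idx i).+1 => x y xy; apply: fF => i iF.
rewrite -(siteK i); apply: xy; rewrite ltnS; exact: leq_bigmax_seq.
Qed.

Lemma initially_local_Cyl w : initially_local (size w) (\1_(Cyl w)).
Proof.
have H x y : (forall k, (k < size w)%N -> x (site k) = y (site k)) ->
    Cyl w x -> Cyl w y.
  move=> xy /matchesE xw; rewrite -xw; apply/CylP => i iw.
  by rewrite xy.
move=> x y xy; rewrite !indicE; congr (nat_of_bool _)%:R.
by apply/idP/idP; rewrite !inE; apply: H => // k /xy.
Qed.

Lemma quasi_local_Cyl w : quasi_local (\1_(Cyl w) : config G -> R).
Proof.
exact: local_quasi_local (initially_local_on (@initially_local_Cyl w)).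
Qed.

Definition cyl_mass w : R := lim_gam (\1_(Cyl w)).

Lemma truncated_Cyl w k :
  truncated (\1_(Cyl w)) (site (size w)) k = \1_(Cyl (k :: w)) :> (config G -> R).
Proof.
apply: funext => x; rewrite /truncated !indicE -natrM mulnb; congr (nat_of_bool _)%:R.
apply/andP/idP; rewrite !inE.
  by move=> [xw /eqP <-]; split.
by move=> [/eqP xk xw]; split.
Qed.

Lemma Cyl_nil : Cyl [::] = setT. Proof. by []. Qed.

Lemma cyl_mass_ge0 w : 0 <= cyl_mass w.
Proof.
by apply: lim_gam_ge0 => //; [exact: unit_valued_indic|exact: quasi_local_Cyl].
Qed.

Lemma cyl_mass_nil : cyl_mass [::] = 1.
Proof.
rewrite /cyl_mass Cyl_nil indicT; apply: lim_gam_cst => //.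
by rewrite ler01 lexx.
Qed.

Lemma cyl_mass_split w :
  \sum_(k < n) cyl_mass (val k :: w) @[n --> \oo] --> cyl_mass w.
Proof.
have := lim_gam_split q_ge0 q_sum1 q_bal decay E_mono E_cover (site (size w))
  (unit_valued_indic (Cyl w)) (initially_local_on (@initially_local_Cyl w)).
by under eq_fun do under eq_bigr do rewrite truncated_Cyl.
Qed.

Let digits := itv_digits cyl_mass.

Let measurable_matches w :
  measurable ([set u | matches w (digits u)] : set (measurableTypeR R)).
Proof.
elim: w => [|k w ih]; first exact: measurableT.
apply: measurableI ih; apply: measurable_digit.
- exact: cyl_mass_ge0.
- exact: cyl_mass_nil.
- exact: cyl_mass_split.
Qed.

Let decode (u : measurableTypeR R) : borel_config G := fun i => digits u (idx i).

Let decode_Cyl w : decode @^-1` (Cyl w) = [set u | matches w (digits u)].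
Proof.
apply/seteqP; split => u /=; rewrite /Cyl /= /decode;
  by under eq_fun do rewrite idxK.
Qed.

Let measurable_decode : measurable_fun setT decode.
Proof.
apply: (measurability (range Cyl)); first exact: borel_config_Cyl siteK.
by move=> _ [_ [w _ <-] <-]; rewrite setTI decode_Cyl.
Qed.

Let decode_mfun : {mfun measurableTypeR R >-> borel_config G} :=
  mfun_Sub (mem_set measurable_decode).

Theorem exists_limit_measure : exists mu : probability (borel_config G) R,
  forall w, mu (Cyl w) = (cyl_mass w)%:E.
Proof.
exists (distribution (@unit_interval_measure R :
  probability (measurableTypeR R) R) decode_mfun) => w.
change (unit_interval_measure (decode @^-1` (Cyl w)) = (cyl_mass w)%:E).
rewrite decode_Cyl; apply: unit_interval_matches.
- exact: cyl_mass_ge0.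
- exact: cyl_mass_nil.
- exact: cyl_mass_split.
Qed.

(** [f] is constant on each cylinder of length [n], so every preimage is a countable union of
    cylinders, whatever the target space. *)
Lemma measurable_initially_local d (T : measurableType d) n
    (f : config G -> T) :
  (forall x y, (forall k, (k < n)%N -> x (site k) = y (site k)) -> f x = f y) ->
  measurable_fun setT (f : borel_config G -> T).
Proof.
move=> fn _ Y mY; rewrite setTI.
pose C w := `[< size w = n /\ exists2 x, Cyl w x & Y (f x) >].
rewrite (_ : f @^-1` Y = \bigcup_w (if C w then Cyl w else set0)).
  apply: countable_bigcupT_measurable => // w.
  by case: ifP => // _; exact: measurable_Cyl.
apply/seteqP; split => [x /= Yx|x [w _]].
  exists (word_of (fun n => x (site n)) n) => //.
  rewrite ifT; first exact/CylP.
  by apply/asboolP; rewrite size_word_of; split => //; exists x => //; exact/CylP.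
case: ifPn => // /asboolP[wn [z zw Yz]] xw /=.
rewrite (fn x z)// => k kn; move: zw xw => /matchesE <- /CylP ->//.
by rewrite wn.
Qed.

Lemma measurable_quasi_local f : quasi_local f ->
  measurable_fun setT (f : borel_config G -> R).
Proof.
move=> fq; pose h n : config G -> R := fun x => f (overlay (sites n) x x0).
apply: (@measurable_fun_cvg _ (borel_config G) R setT h f) => [m|x _].
  apply: (@measurable_initially_local _ _ m) => x y xy; congr f.
  apply: funext => i; rewrite /overlay; case: ifPn => //.
  rewrite inE => /mapP[k]; rewrite mem_iota => /andP[_ km] ->; exact: xy.
apply/cvgrPdist_le => e e0; have [F hF] := fq _ e0.
exists (\max_(i <- F) idx i).+1 => // n /= Fn; apply: hF => i iF.
rewrite /overlay -(siteK i) sites_mem//; apply: leq_trans Fn.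
by rewrite ltnS; exact: leq_bigmax_seq.
Qed.

Lemma le_integral_unit (nu : probability (borel_config G) R) f g (e : R) :
  unit_valued f -> unit_valued g -> 0 <= e ->
  measurable_fun setT (f : borel_config G -> R) ->
  measurable_fun setT (g : borel_config G -> R) ->
  (forall x, f x <= g x + e) ->
  (\int[nu]_x (f x)%:E <= \int[nu]_x (g x)%:E + e%:E)%E.
Proof.
move=> f01 g01 e0 mf mg fg.
have -> : e%:E = (\int[nu]_x (cst e%:E) x)%E.
  by rewrite integral_cst// [X in (_ * X)%E]probability_setT mule1.
rewrite -ge0_integralD//; last 2 first.
- by move=> x _; rewrite lee_fin; have /andP[] := g01 x.
- exact/measurable_EFinP.
apply: ge0_le_integral => //.
- by move=> x _; rewrite lee_fin; have /andP[] := f01 x.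
- exact/measurable_EFinP.
- apply: emeasurable_funD; [exact/measurable_EFinP|exact: measurable_cst].
- by move=> x _; rewrite -EFinD lee_fin.
Qed.

(** * Integration against a measure with the limiting cylinder masses *)

Section limit_measure.
Variable mu : probability (borel_config G) R.
Hypothesis mu_Cyl : forall w, mu (Cyl w) = (cyl_mass w)%:E.

Lemma Cyl_split w : Cyl w = \bigcup_k Cyl (k :: w).
Proof.
apply/seteqP; split => [x xw|x [k _ []]//].
by exists (x (site (size w))).
Qed.

Lemma trivIset_Cyl w : trivIset setT (fun k => Cyl (k :: w)).
Proof. by move=> k l _ _ [x [[<- _] [<- _]]]. Qed.

Lemma initially_localM_Cyl n f w : initially_local n f ->
  initially_local (maxn n (size w)) (fun x => f x * \1_(Cyl w) x).
Proof.
move=> fn x y xy; congr (_ * _).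
  by apply: fn => k kn; apply: xy; rewrite leq_max kn.
by apply: initially_local_Cyl => k kn; apply: xy; rewrite leq_max kn orbT.
Qed.

(** Induction on the letters that [w] lacks to reach length [n]. At full length [f] is constant on
    the cylinder; before that, both sides split over the next letter, the left by countable
    additivity and the right by [lim_gam_split]. *)
Lemma integral_Cyl n f w : unit_valued f -> initially_local n f ->
  (size w <= n)%N -> (\int[mu]_(x in Cyl w) (f x)%:E =
    (lim_gam (fun x => f x * \1_(Cyl w) x))%:E)%E.
Proof.
move=> f01 fn wn; move: {2}(n - size w)%N (erefl (n - size w)%N) => m.
elim: m w wn => [|m ih] w wn nw.
  have [c c01 fc] : exists2 c : R, 0 <= c <= 1 & forall x, Cyl w x -> f x = c.
    have [[z zw]|no] := pselect (exists z, Cyl w z).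
      exists (f z) => // x xw; apply: fn => k kn.
      have kw : (k < size w)%N by rewrite (leq_trans kn)// -subn_eq0 nw.
      by move: zw xw => /matchesE <- /CylP ->.
    exists 0; first by rewrite lexx ler01.
    by move=> x xw; exfalso; apply: no; exists x.
  transitivity (\int[mu]_(x in Cyl w) (cst c%:E) x)%E.
    by apply: eq_integral => x; rewrite inE => /fc ->.
  rewrite integral_cst; last exact: measurable_Cyl.
  rewrite [X in (_ * X)%E]mu_Cyl -EFinM; congr EFin; rewrite -[LHS]lim_gam_properZ//.
  - congr lim_gam; apply: funext => x; rewrite !indicE.
    case: (boolP (x \in Cyl w)) => [|_]; last by rewrite !mulr0.
    by rewrite inE => /fc ->.
  - exact: unit_valued_indic.
  - exact: quasi_local_Cyl.
have mf : measurable_fun setT (fun x : borel_config G => (f x)%:E).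
  by apply/measurable_EFinP; exact: measurable_initially_local fn.
rewrite Cyl_split ge0_integral_bigcup//; last 4 first.
- by move=> k; exact: measurable_Cyl.
- exact: measurable_funTS.
- by move=> x _; rewrite lee_fin; have /andP[] := f01 x.
- exact: trivIset_Cyl.
rewrite -Cyl_split.
pose g : config G -> R := fun x => f x * \1_(Cyl w) x.
have gE k : (fun x => f x * \1_(Cyl (k :: w)) x) = truncated g (site (size w)) k.
  by apply: funext => x; rewrite -truncated_Cyl /truncated mulrA.
apply: cvg_lim => //.
rewrite (_ : (fun n0 => _) =
   (fun n0 => (\sum_(k < n0) lim_gam (truncated g (site (size w)) k))%:E)).
  apply: cvg_EFin.
    by apply: nearW.
  apply: (lim_gam_split q_ge0 q_sum1 q_bal decay E_mono E_cover).
  - by apply: unit_valuedM => //; exact: unit_valued_indic.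
  - apply: (@initially_local_on (maxn n (size w))); exact: initially_localM_Cyl.
apply: funext => n0; rewrite big_mkord -sumEFin; apply: eq_bigr => k _.
have nw' : (n - size w)%N = m.+1 by [].
by rewrite ih -?gE//=; lia.
Qed.

Lemma integral_initially_local n f : unit_valued f -> initially_local n f ->
  (\int[mu]_x (f x)%:E = (lim_gam f)%:E)%E.
Proof.
move=> f01 fn; have := @integral_Cyl n f [::] f01 fn (leq0n _).
rewrite Cyl_nil => ->; congr (lim_gam _)%:E.
by apply: funext => x; rewrite indicT mulr1.
Qed.

Lemma integral_quasi_local f : unit_valued f -> quasi_local f ->
  (\int[mu]_x (f x)%:E = (lim_gam f)%:E)%E.
Proof.
move=> f01 fq; have mf := measurable_quasi_local fq.
(* One [e] pays for replacing [f] by a local function in the integral, the other for the same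
   replacement in [lim_gam]. *)
have near_le (e : R) : 0 < e ->
    (\int[mu]_x (f x)%:E <= (lim_gam f)%:E + (e + e)%:E)%E /\
    ((lim_gam f)%:E <= \int[mu]_x (f x)%:E + (e + e)%:E)%E.
  move=> e0; have [F hF] := fq _ e0.
  pose h : config G -> R := fun x => f (overlay F x x0).
  have h01 : unit_valued h by move=> x; exact: f01.
  have hl : local_on F h.
    move=> x y xy; rewrite /h; congr f; apply: funext => i; rewrite /overlay.
    by case: ifPn => // /xy.
  have fh x : `|f x - h x| <= e.
    by apply: hF => i iF; rewrite /overlay iF.
  have [n hn] := local_on_initially hl.
  have mh := measurable_initially_local hn.
  have := lim_gam_close q_ge0 q_sum1 q_bal decay E_mono E_cover f01 fq h01
    (local_quasi_local hl) (ltW e0) fh.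
  have fhe x : f x <= h x + e by have := fh x; rewrite ler_norml; lra.
  have hfe x : h x <= f x + e by have := fh x; rewrite ler_norml; lra.
  have := le_integral_unit mu f01 h01 (ltW e0) mf mh fhe.
  have := le_integral_unit mu h01 f01 (ltW e0) mh mf hfe.
  rewrite (integral_initially_local h01 hn) ler_norml => l1 l2 l3.
  split.
    apply: le_trans l2 _; rewrite -!EFinD lee_fin; lra.
  rewrite [in leRHS]EFinD addeA; apply: le_trans (leeD2r _ l1).
  by rewrite -EFinD lee_fin; lra.
apply/eqP; rewrite eq_le; apply/andP; split; apply/lee_addgt0Pr => e e0;
  have [|l1 l2] := near_le (e / 2); rewrite ?divr_gt0//; move: l1 l2;
  by rewrite -splitr.
Qed.

(** Apply [gam_sens] to the exterior of a large [L]: since [F] lies in [L] the function does not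
    change, and only the tail of [theta K] remains. *)
Lemma gam_quasi_local K F f : unit_valued f -> local_on F f ->
  quasi_local (gam K f).
Proof.
move=> f01 fF e e0; have [S hS] := theta_tail K e0.
exists (S `|` (K `|` F))%fset => x y xy.
set L := (S `|` (K `|` F))%fset in xy *.
have SL : (S `<=` L)%fset by exact: fsubsetUl.
apply: le_trans (hS L SL).
have := @gam_sens _ _ q q_ge0 q_sum1 theta theta_ge0 q_sens K (~` [set` L]) f x y 1 0.
rewrite mulr1 add0r; apply => //.
- by move=> i iK; apply; rewrite /= !inE iK orbT.
- by move=> i /= /contrapT; exact: xy.
- move=> u v _; have := f01 u; have := f01 v; rewrite ler_norml; lra.
- move=> u v uv; rewrite (fF u v) ?subrr ?normr0// => i iF; apply: uv => /=.
  by apply; rewrite !inE iF !orbT.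
Qed.

Lemma q_unit K : unit_valued (q K).
Proof.
move=> x; rewrite q_ge0/= -lee_fin -(q_sum1 K x).
apply: esum_ge; exists [set x]; last by rewrite fsbig_set1.
by split; [exact: finite_set1|move=> y ->; exact: cls_refl].
Qed.

(** Makes the density measurable, which is needed to average indicators of arbitrary Borel sets. *)
Lemma quasi_local_q K : quasi_local (q K).
Proof.
move=> e e0; have [S hS] := theta_tail K e0.
exists (S `|` K)%fset => x y xy; set L := (S `|` K)%fset in xy *.
have SL : (S `<=` L)%fset by exact: fsubsetUl.
have KL i : i \in K -> ~ (~` [set` L]) i.
  by move=> iK; apply; rewrite /= !inE iK orbT.
have xyL : eq_off (~` [set` L]) x y by move=> i /= /contrapT; exact: xy.
have h1 := q_sens KL xyL; have h2 := q_sens KL (eq_off_sym xyL).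
have h3 := hS L SL; have t0 := theta_ge0 K (~` [set` L]).
have /andP[x0' x1] := q_unit K x; have /andP[y0 y1] := q_unit K y.
have h4 : theta K (~` [set` L]) * q K y <= theta K (~` [set` L]).
  by rewrite ler_piMr.
have h5 : theta K (~` [set` L]) * q K x <= theta K (~` [set` L]).
  by rewrite ler_piMr.
rewrite ler_norml; lra.
Qed.

(** The configurations as a measurable type for [sigma_coord D], so that measurability in the
    exterior coordinates can be stated with [measurable_fun]. *)
Definition coord_sigma D := g_sigma_algebraType
  (\bigcup_(i in D) preimage_set_system setT (fun x : config G => x i) setT).

Lemma measurable_splice K (w : {ffun K -> nat}) :
  measurable_fun setT
    (fun x : coord_sigma (~` [set` K]) => splice w x : borel_config G).
Proof.
apply: (measurability (range Cyl)); first exact: borel_config_Cyl siteK.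
move=> _ [_ [v _ <-] <-]; rewrite setTI; elim: v => [|k v ih].
  exact: measurableT.
apply: (@measurableI _ (coord_sigma (~` [set` K]))
  [set x | splice w x (site (size v)) = k] _ _ ih).
have [sK|sK] := boolP (site (size v) \in K).
  have [e|e] := pselect (splice w x0 (site (size v)) = k).
    rewrite [X in measurable X](_ : _ = setT)//; apply/seteqP; split => // x _.
    by rewrite -e /= /splice; case: insubP => //; rewrite sK.
  rewrite [X in measurable X](_ : _ = set0)//; apply/seteqP; split => // x.
  by move: e; rewrite /= /splice; case: insubP => //; rewrite sK.
apply: sub_sigma_algebra; exists (site (size v)); first exact/negP.
exists [set k] => //; rewrite setTI; apply/seteqP; split => x /=;
  by rewrite /splice insubF//; exact/negbTE.
Qed.

Lemma sub_sigma_coord D : sigma_coord D `<=` (measurable : set (set (borel_config G))).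
Proof.
apply: smallest_sub; first exact: sigma_algebra_measurable.
by move=> _ [i _ [A _ <-]]; rewrite setTI; exact: measurable_coord.
Qed.

(** Indexing by words on [K] instead of by the class makes the index set countable and independent
    of [x]; each term depends on [x] only through [splice], hence through the exterior. *)
Lemma measurable_gam_coord K f : unit_valued f ->
  measurable_fun setT (f : borel_config G -> R) ->
  measurable_fun setT
    (fun x : coord_sigma (~` [set` K]) => (gam K f x)%:E).
Proof.
move=> f01 mf.
have fE x : (gam K f x)%:E = \esum_(w in [set: {ffun K -> nat}])
    (q K (splice w x) * f (splice w x))%:E.
  by rewrite gamE// (reindex_esum _ _ _ _ (splice_bij K x)).
apply: (eq_measurable_fun (fun x : coord_sigma (~` [set` K]) =>
  \esum_(w in [set: {ffun K -> nat}])
    (q K (splice w x) * f (splice w x))%:E)) => [x _|]; first by rewrite fE.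
apply: emeasurable_esum => [w x|w]; first exact: qf_ge0.
apply/measurable_EFinP; apply: measurable_funM.
  exact: (measurableT_comp (measurable_quasi_local (@quasi_local_q K))
    (@measurable_splice K w)).
exact: (measurableT_comp mf (@measurable_splice K w)).
Qed.

Lemma measurable_gam K f : unit_valued f ->
  measurable_fun setT (f : borel_config G -> R) ->
  measurable_fun setT (fun x : borel_config G => (gam K f x)%:E).
Proof.
move=> f01 mf _ Y mY; rewrite setTI; apply: (@sub_sigma_coord (~` [set` K])).
have := @measurable_gam_coord K f f01 mf measurableT Y mY.
by rewrite setTI.
Qed.

Lemma gam_indicE K (B : set (config G)) x :
  (gam K \1_B x)%:E = \esum_(y in cls K x `&` B) (q K y)%:E.
Proof.
rewrite gamE//; last exact: unit_valued_indic.
rewrite esum_mkcondr; apply: eq_esum => y _; rewrite indicE.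
by case: ifP; rewrite ?mulr1 ?mulr0.
Qed.

Lemma measurable_gam_indic K (B : set (borel_config G)) : measurable B ->
  measurable_fun setT (fun x : borel_config G => (gam K \1_B x)%:E).
Proof.
move=> mB; apply: measurable_gam; first exact: unit_valued_indic.
exact: measurable_indic.
Qed.

Definition mean_gam (nu : probability (borel_config G) R) K
    (B : set (borel_config G)) : \bar R :=
  (\int[nu]_x (gam K \1_B x)%:E)%E.

Section mean_gam_measure.
Variables (nu : probability (borel_config G) R) (K : {fset G}).

Let mean_gam0 : mean_gam nu K set0 = 0%E.
Proof.
rewrite /mean_gam; apply: integral0_eq => x _.
by rewrite gam_indicE setI0 esum_set0.
Qed.

Let mean_gam_ge0 B : (0 <= mean_gam nu K B)%E.
Proof.
apply: integral_ge0 => x _; rewrite gam_indicE.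
by apply: esum_ge0 => y _; rewrite lee_fin.
Qed.

(* [mean_gam] is only a measure on Borel sets, on which the integrand is
   measurable. *)
Let mean_gam_sigma_additive : semi_sigma_additive (mean_gam nu K).
Proof.
move=> F mF tF mUF.
have -> : mean_gam nu K (\bigcup_n F n) = (\sum_(n <oo) mean_gam nu K (F n))%E.
  rewrite /mean_gam -integral_nneseries//; last 2 first.
  - by move=> n; exact: measurable_gam_indic.
  - move=> n x _; rewrite gam_indicE.
    by apply: esum_ge0 => y _; rewrite lee_fin.
  apply: eq_integral => x _; rewrite gam_indicE setI_bigcupr.
  rewrite nneseries_sum_bigcup.
  - by apply: eq_eseriesr => n _; rewrite gam_indicE.
  - by apply: trivIset_setIl.
  - by move=> y; rewrite lee_fin.
by apply: is_cvg_nneseries => n _ _; exact: mean_gam_ge0.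
Qed.

HB.instance Definition _ := isMeasure.Build _ _ _ (mean_gam nu K)
  mean_gam0 mean_gam_ge0 mean_gam_sigma_additive.

End mean_gam_measure.

(** Invariance of [mu] under the kernels. On a cylinder the averaged indicator is quasi-local, so
    its integral is a limit of finite-volume averages, which consistency leaves unchanged; cylinders
    determine the measure. *)
Lemma mean_gam_mu K (B : set (borel_config G)) : measurable B ->
  mean_gam mu K B = mu B.
Proof.
apply: (borel_config_unique siteK) => [w|]; last first.
  rewrite /mean_gam; apply: (@le_lt_trans _ _ 1%E); last exact: ltry.
  rewrite -(@probability_setT _ _ _ mu) -[leRHS]mul1e -integral_cst//.
  apply: ge0_le_integral => //.
  - by move=> x _; rewrite lee_fin;
    have /andP[] := gam_unit q_ge0 q_sum1 K (unit_valued_indic setT) x.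
  - exact: measurable_gam_indic.
  - by move=> x _; rewrite lee_fin;
    have /andP[] := gam_unit q_ge0 q_sum1 K (unit_valued_indic setT) x.
transitivity (cyl_mass w)%:E; last exact/esym/mu_Cyl.
rewrite /= /mean_gam integral_quasi_local.
- congr EFin; apply: lim_gam_gam => //.
  + exact: unit_valued_indic.
  + exact: quasi_local_Cyl.
- by apply: gam_unit => //; exact: unit_valued_indic.
- apply: gam_quasi_local; first exact: unit_valued_indic.
  exact: initially_local_on (@initially_local_Cyl w).
Qed.

(** The sets that do not separate [x] from [y] form a sigma-algebra containing the generators. *)
Lemma sigma_coord_invariant K (A : set (config G)) x y :
  sigma_coord (~` [set` K]) A -> eq_off [set` K] x y -> A x -> A y.
Proof.
move=> sA xy; pose inv (B : set (config G)) := B x <-> B y.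
suff : inv A by move=> [].
suff : sigma_coord (~` [set` K]) `<=` inv by apply.
apply: smallest_sub => [|B [i iK [C _ <-]]].
  split=> [//|B|F hF]; rewrite /inv.
  - by move=> h; rewrite !setTD /setC /=; split=> + /h.
  - by split=> -[n _ Fn]; exists n => //; apply/(hF n).
by rewrite /inv !setTI /= xy.
Qed.

(** The indicator of the exterior event [A] passes through the kernel, which reduces the equation to
    invariance at the event where [A] and [B] meet. *)
Theorem limit_measure_DLR K (A B : set (borel_config G)) : measurable B ->
  sigma_coord (~` [set` K]) A ->
  (\int[mu]_(x in A) (gam K \1_B x)%:E = mu (A `&` B))%E.
Proof.
move=> mB sA; have mA := sub_sigma_coord sA.
rewrite -(@mean_gam_mu K); last exact: measurableI.
rewrite /mean_gam integral_mkcond; apply: eq_integral => x _.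
rewrite patchE.
have -> : \1_(A `&` B) = (fun y => \1_A y * \1_B y) :> (config G -> R).
  by apply: funext => y; rewrite indicI.
rewrite (@gam_properM _ _ q q_ge0 q_sum1 K \1_A \1_B x).
- by rewrite indicE; case: ifP; rewrite ?mul1r ?mul0r.
- exact: unit_valued_indic.
- exact: unit_valued_indic.
- move=> y xy; rewrite !indicE; congr (nat_of_bool _)%:R.
  apply/idP/idP; rewrite !inE; apply: sigma_coord_invariant sA _ => //.
  exact: eq_off_sym.
Qed.

Lemma gam_cond_prob K (B : set (borel_config G)) : measurable B ->
  is_cond_prob mu (sigma_coord (~` [set` K])) B
    (fun x => (gam K \1_B x)%:E).
Proof.
move=> mB; have mg := measurable_gam_indic K mB; split.
- move=> Y mY; have := @measurable_gam_coord K \1_B (unit_valued_indic B)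
    (@measurable_indic _ _ R setT B mB) measurableT Y mY.
  by rewrite setTI.
- apply: (@le_integrable _ _ _ mu setT measurableT _ (cst 1%E)) => //.
    move=> x _; rewrite /= normr1 lee_fin ger0_norm;
      by have /andP[] := gam_unit q_ge0 q_sum1 K (unit_valued_indic B) x.
  exact: finite_measure_integrable_cst.
- by move=> A sA; exact: limit_measure_DLR.
Qed.

(** The DLR equation on the whole space gives [nu (Cyl w)] as the integral of an average in [E n],
    which is within [e] of [cyl_mass w] for every boundary condition. *)
Theorem limit_measure_unique (nu : probability (borel_config G) R) :
  (forall K (B : set (borel_config G)), K != fset0 -> measurable B ->
    exists2 f : borel_config G -> \bar R,
      is_cond_prob nu (sigma_coord (~` [set` K])) B f &
      {ae nu, forall x, f x = (gam K \1_B x)%:E}) ->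
  forall B : set (borel_config G), measurable B -> nu B = mu B.
Proof.
move=> nuDLR; apply: (borel_config_unique siteK) => [w|]; last first.
  by rewrite [X in (X < _)%E]probability_setT ltry.
have Cw01 := unit_valued_indic (Cyl w); have Cwq := @quasi_local_Cyl w.
have near_le (e : R) : 0 < e ->
    (nu (Cyl w) <= (cyl_mass w)%:E + e%:E)%E /\
    ((cyl_mass w)%:E <= nu (Cyl w) + e%:E)%E.
  move=> e0; have [n0 hn0] := quasi_local_lim q_ge0 q_sum1 q_bal decay E_mono
    E_cover Cw01 Cwq e0.
  (* The DLR equations are assumed for nonempty volumes only, so [E n] is made to contain a site. *)
  have [n1 hn1] := E_cover [fset site 0]%fset.
  pose n := maxn n0 n1; have h := hn0 n (leq_maxl _ _).
  have En0 : E n != fset0.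
    apply/fset0Pn; exists (site 0); apply: (fsubsetP (E_mono (leq_maxr n0 n1))).
    by apply: (fsubsetP hn1); rewrite inE.
  have [f [_ fint fA] fae] := nuDLR (E n) (Cyl w) En0 (measurable_Cyl site w).
  have := fA setT; rewrite setTI => <-; last first.
    by case: (@smallest_sigma_algebra _ setT
      (\bigcup_(i in ~` [set` E n]) preimage_set_system setT
        (fun x : config G => x i) setT)) => [h0 hC _];
      rewrite -(setD0 setT); apply: hC.
  have -> : (\int[nu]_x f x = \int[nu]_x (gam (E n) \1_(Cyl w) x)%:E)%E.
    apply: ae_eq_integral => //.
    - exact: measurable_int fint.
    - exact: measurable_gam_indic (measurable_Cyl site w).
    - case: fae => A [mA A0 fA']; exists A; split => // x /= fx.
      by apply: fA' => /= fx'; apply: fx => _.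
  have mg := measurable_gam_indic (E n) (measurable_Cyl site w).
  have g01 := gam_unit q_ge0 q_sum1 (E n) Cw01.
  have mg' : measurable_fun setT (gam (E n) \1_(Cyl w) : borel_config G -> R).
    exact/measurable_EFinP.
  have c01 : unit_valued (fun _ : config G => cyl_mass w).
    move=> x; rewrite cyl_mass_ge0 /=.
    exact: (lim_gam_le1 q_ge0 q_sum1 q_bal decay E_mono E_cover Cw01 Cwq).
  have mc : measurable_fun setT ((fun=> cyl_mass w) : borel_config G -> R).
    exact: measurable_cst.
  have cE : (\int[nu]_x (cyl_mass w)%:E = (cyl_mass w)%:E)%E.
    by rewrite integral_cst// [X in (_ * X)%E]probability_setT mule1.
  rewrite -[in X in X /\ _]cE -[in X in _ /\ X]cE; split.
    apply: le_integral_unit => //; first exact: ltW.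
    by move=> x; have := h x; rewrite ler_norml -/(cyl_mass w); lra.
  apply: le_integral_unit => //; first exact: ltW.
  by move=> x; have := h x; rewrite ler_norml -/(cyl_mass w); lra.
transitivity (cyl_mass w)%:E; last exact/esym/mu_Cyl.
apply/eqP; rewrite eq_le; apply/andP; split;
  apply/lee_addgt0Pr => e e0; by have [] := near_le e e0.
Qed.

End limit_measure.

End dobrushin_measure.

(** * The pair energy *)

Section rsum.
Variables (R : realType) (T : choiceType).
Implicit Types (A B : set T) (v w : T -> R).

(** [fine] turns a divergent sum into 0, hence the [rsummable] side conditions below. *)
Definition rsum A v : R := fine (\esum_(i in A) (v i)%:E).

Definition rsummable A v := (\esum_(i in A) (v i)%:E < +oo)%E.

Lemma rsummable_le A B v w : A `<=` B -> (forall i, A i -> v i <= w i) ->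
  (forall i, 0 <= w i) -> rsummable B w -> rsummable A v.
Proof.
move=> AB vw w0; apply: le_lt_trans; exact: ge0_sub_esum.
Qed.

Lemma rsumE A v : (forall i, 0 <= v i) -> rsummable A v ->
  (rsum A v)%:E = \esum_(i in A) (v i)%:E.
Proof.
by move=> v0 sv; rewrite fineK// ge0_fin_numE// esum_ge0// => i _; rewrite lee_fin.
Qed.

Lemma rsum_ge0 A v : (forall i, 0 <= v i) -> 0 <= rsum A v.
Proof. by move=> v0; rewrite fine_ge0// esum_ge0// => i _; rewrite lee_fin. Qed.

Lemma le_rsum A B v w : A `<=` B -> (forall i, A i -> v i <= w i) ->
  (forall i, 0 <= v i) -> (forall i, 0 <= w i) -> rsummable B w ->
  rsum A v <= rsum B w.
Proof.
move=> AB vw v0 w0 sw; have sv := rsummable_le AB vw w0 sw.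
by rewrite -lee_fin !rsumE//; exact: ge0_sub_esum.
Qed.

Lemma rsumID B A v : (forall i, 0 <= v i) -> rsummable A v ->
  rsum A v = rsum (A `&` B) v + rsum (A `&` ~` B) v.
Proof.
move=> v0 sv; apply: EFin_inj; rewrite EFinD !rsumE//.
- by apply: esumID => i _; rewrite lee_fin.
- by apply: rsummable_le sv => // i [].
- by apply: rsummable_le sv => // i [].
Qed.

Lemma rsumU A B v : A `&` B = set0 -> (forall i, 0 <= v i) ->
  rsummable (A `|` B) v -> rsum (A `|` B) v = rsum A v + rsum B v.
Proof.
move=> AB v0 sv; apply: EFin_inj; rewrite EFinD !rsumE//.
- by apply: esumU => // i; rewrite lee_fin.
- by apply: rsummable_le sv => // i; right.
- by apply: rsummable_le sv => // i; left.
Qed.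

Lemma eq_rsum A v w : (forall i, A i -> v i = w i) -> rsum A v = rsum A w.
Proof. by move=> vw; congr fine; apply: eq_esum => i /vw ->. Qed.

End rsum.

Lemma sum_fset_split (V : nmodType) (T : choiceType) (K L : {fset T})
    (f : T -> V) : (K `<=` L)%fset ->
  \sum_(i <- L) f i = \sum_(i <- K) f i + \sum_(i <- (L `\` K)%fset) f i.
Proof.
move=> KL; rewrite (big_fsetID _ (fun i => i \in K))/=; congr (_ + _).
  congr bigop; congr enum_fset; apply/fsetP => i; rewrite !inE.
  by case: (boolP (i \in K)) => iK; rewrite ?andbF// (fsubsetP KL).
by congr bigop; congr enum_fset; apply/fsetP => i; rewrite !inE andbC.
Qed.

Section pair_energy.
Variables (R : realType) (G : groupType) (c : G -> nat -> R).
Hypothesis c_ge0 : forall g n, 0 <= c g n.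
Hypothesis c_fin : (\esum_(h in [set h | h != 1%g]) sup_c c h < +oo)%E.
Implicit Types (J : set G) (K L S : {fset G}) (x y : config G) (i j : G).

Definition cmax g : R := fine (sup_c c g).

Lemma sup_c_ge0 g : (0 <= sup_c c g)%E.
Proof.
apply: (@le_trans _ _ (c g 0%N)%:E); first by rewrite lee_fin.
by apply: ereal_sup_ubound; exists 0%N.
Qed.

Lemma cmaxE g : g != 1%g -> (cmax g)%:E = sup_c c g.
Proof.
move=> g1; rewrite fineK// ge0_fin_numE; last exact: sup_c_ge0.
apply: le_lt_trans c_fin; apply: esum_ge; exists [set g].
  by split; [exact: finite_set1|move=> h ->].
by rewrite fsbig_set1.
Qed.

Lemma cmax_ge0 g : 0 <= cmax g.
Proof. by rewrite fine_ge0// sup_c_ge0. Qed.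

Lemma c_le_cmax g n : g != 1%g -> c g n <= cmax g.
Proof. by move=> g1; rewrite -lee_fin cmaxE//; apply: ereal_sup_ubound; exists n. Qed.

Definition total_c : R := rsum [set h | h != 1%g] cmax.

Lemma summable_cmax : rsummable [set h | h != 1%g] cmax.
Proof.
by rewrite /rsummable (eq_esum (b := sup_c c))// => g /= /cmaxE.
Qed.

Definition pair_coupling (x : config G) (p : G * G) : R :=
  c (p.2 * p.1^-1)%g (x p.1) * (x p.1 == x p.2)%:R.

Definition pair_bound (p : G * G) : R := cmax (p.2 * p.1^-1)%g.

(* In an ordered pair [(i, j)], the site [i] is the one whose value enters [c]:
   it contributes [c (j i^-1) (x i)] to the energy when [x i = x j]. *)
Definition pairs K : set (G * G) :=
  [set p | p.1 != p.2 /\ (p.1 \in K \/ p.2 \in K)].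

Definition touching J : set (G * G) := [set p | J p.1 \/ J p.2].

Lemma pair_coupling_ge0 x p : 0 <= pair_coupling x p.
Proof. by rewrite mulr_ge0. Qed.

Lemma pair_bound_ge0 p : 0 <= pair_bound p. Proof. exact: cmax_ge0. Qed.

Lemma pair_ratio_neq1 (p : G * G) : p.1 != p.2 -> (p.2 * p.1^-1)%g != 1%g.
Proof. by apply: contra_neq => /divg1_eq. Qed.

Lemma pair_coupling_le x p : p.1 != p.2 -> pair_coupling x p <= pair_bound p.
Proof.
move=> /pair_ratio_neq1 p1; rewrite /pair_coupling.
apply: le_trans (c_le_cmax (x p.1) p1); rewrite ler_piMr//.
by rewrite lern1 leq_b1.
Qed.

Lemma pairs1E i : pairs [fset i]%fset =
  [set p | p.1 = i /\ p.2 != i] `|` [set p | p.2 = i /\ p.1 != i].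
Proof.
apply/seteqP; split => [[g h] /= [gh]|[g h] /=].
  by rewrite !inE => -[] /eqP e; [left|right]; rewrite -e; split=> //; rewrite eq_sym.
rewrite /pairs /= !inE; case=> -[-> gh]; rewrite eqxx; split => //.
- by rewrite eq_sym.
- by left.
- by right.
Qed.

Lemma esum_row_bound i :
  \esum_(p in [set p | p.1 = i /\ p.2 != i]) (pair_bound p)%:E = total_c%:E.
Proof.
rewrite rsumE; [|exact: cmax_ge0|exact: summable_cmax].
rewrite (reindex_esum [set h | h != 1%g] _ (fun h => (i, (h * i)%g))).
  by apply: eq_esum => h _; rewrite /pair_bound /= mulgK.
split=> [h /= h1|h k _ _ [/mulIg]//|[g k] /= [-> ki]].
  by split=> //; apply: contra_neq h1 => hi; apply: (mulIg i); rewrite mul1g.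
exists (k * i^-1)%g; first by apply: (@pair_ratio_neq1 (i, k)); rewrite eq_sym.
by rewrite mulgVK.
Qed.

Lemma esum_col_bound i :
  \esum_(p in [set p | p.2 = i /\ p.1 != i]) (pair_bound p)%:E = total_c%:E.
Proof.
rewrite rsumE; [|exact: cmax_ge0|exact: summable_cmax].
rewrite (reindex_esum [set h | h != 1%g] _ (fun h => ((h^-1 * i)%g, i))).
  by apply: eq_esum => h _; rewrite /pair_bound /= invgM invgK mulVKg.
split=> [h /= h1|h k _ _ [/mulIg/invg_inj]//|[k g] /= [-> ki]].
  split=> //; apply: contra_neq h1 => hi; apply: invg_inj; rewrite invg1.
  by apply: (mulIg i); rewrite mul1g.
exists (i * k^-1)%g; first by apply: (@pair_ratio_neq1 (k, i)).
by rewrite invgM invgK mulgVK.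
Qed.

(** The pairs with first site [i] and those with second site [i] contribute [total_c] each: this is
    one of the two factors 2 in the constant 4. *)
Lemma esum_pairs1 i :
  \esum_(p in pairs [fset i]%fset) (pair_bound p)%:E = (total_c + total_c)%:E.
Proof.
rewrite pairs1E esumU; last 2 first.
- by apply/seteqP; split => // -[g h] /= [[-> hi] [hi' _]]; rewrite hi' eqxx in hi.
- by move=> p; rewrite lee_fin pair_bound_ge0.
by rewrite esum_row_bound esum_col_bound.
Qed.

Lemma pairs_seq_summable (s : seq G) :
  rsummable [set p | p.1 != p.2 /\ (p.1 \in s \/ p.2 \in s)] pair_bound.
Proof.
rewrite /rsummable; elim: s => [|i s ih].
  by rewrite esum1 ?ltry// => p [_ []].
apply: (@le_lt_trans _ _ (\esum_(p in pairs [fset i]%fset `|`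
    [set p | p.1 != p.2 /\ (p.1 \in s \/ p.2 \in s)]) (pair_bound p)%:E)).
  apply: sub_esum => [p /= [p12]|p]; last by rewrite lee_fin pair_bound_ge0.
  rewrite !inE => -[|] /orP[pi|ps].
  - by left; split=> //; left; rewrite inE.
  - by right; split=> //; left.
  - by left; split=> //; right; rewrite inE.
  - by right; split=> //; right.
apply: le_lt_trans (esumU_le _ _ _) _.
  by move=> p; rewrite lee_fin pair_bound_ge0.
by rewrite esum_pairs1 lte_add_pinfty// ltry.
Qed.

Lemma pairs_summable K A : A `<=` pairs K -> rsummable A pair_bound.
Proof.
move=> AK; apply: (rsummable_le AK) (pairs_seq_summable (enum_fset K)) => //.
exact: pair_bound_ge0.
Qed.

Lemma coupling_summable K A x : A `<=` pairs K -> rsummable A (pair_coupling x).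
Proof.
move=> AK; apply: rsummable_le (pairs_summable AK) => // [p /AK[p12 _]|p].
  exact: pair_coupling_le.
exact: pair_bound_ge0.
Qed.

(** Pairs joining [K] to its exterior are included, so that changing spins in [K] changes the
    energies of [K] and of any larger volume equally, as [energy_diff] states. *)
Definition energy K x : R :=
  \sum_(i <- K) c 1%g (x i) + rsum (pairs K) (pair_coupling x).

Lemma energy_ge_self K x : \sum_(i <- K) c 1%g (x i) <= energy K x.
Proof. by rewrite lerDl rsum_ge0// => p; exact: pair_coupling_ge0. Qed.

Lemma eq_coupling x y (A : set (G * G)) :
  (forall p, A p -> x p.1 = y p.1 /\ x p.2 = y p.2) ->
  rsum A (pair_coupling x) = rsum A (pair_coupling y).
Proof.
move=> xy; apply: eq_rsum => p /xy[xy1 xy2].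
by rewrite /pair_coupling xy1 xy2.
Qed.

Lemma energy_diff K L x y : (K `<=` L)%fset -> eq_off [set` K] x y ->
  energy L x - energy L y = energy K x - energy K y.
Proof.
move=> KL xy.
have pKL : pairs L `&` pairs K = pairs K.
  apply/setIidr => p [p12 pK]; split => //.
  by case: pK => /(fsubsetP KL); [left|right].
have pairE z : rsum (pairs L) (pair_coupling z) = rsum (pairs K) (pair_coupling z)
    + rsum (pairs L `&` ~` pairs K) (pair_coupling z).
  rewrite (@rsumID _ _ (pairs K)) ?pKL//.
    by move=> p; exact: pair_coupling_ge0.
  exact: (coupling_summable z (@subset_refl _ (pairs L))).
rewrite /energy !(sum_fset_split _ KL) !pairE.
rewrite (@eq_coupling x y (pairs L `&` ~` pairs K)); last first.
  move=> p [[p12 _] pK]; split; apply: xy => /= pk; apply: pK; split => //.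
    by left.
  by right.
rewrite [in LHS](eq_big_seq (fun i => c 1%g (y i))
   (r := enum_fset (L `\` K)%fset)); first by ring.
by move=> i; rewrite inE => /andP[iK _]; rewrite xy//; exact/negP.
Qed.

Definition pair_mass K J : R := rsum (pairs K `&` touching J) pair_bound.

Lemma pair_mass_ge0 K J : 0 <= pair_mass K J.
Proof. by apply: rsum_ge0 => p; exact: pair_bound_ge0. Qed.

(** Only pairs meeting both [K] and [J] change. Each coupling lies between 0 and its bound, so it
    moves by at most that bound, not twice as much. *)
Lemma energy_sensitivity K J x y : (forall i, i \in K -> ~ J i) ->
  eq_off J x y -> energy K x <= energy K y + pair_mass K J.
Proof.
move=> KJ xy; rewrite /energy.
rewrite (eq_big_seq (fun i => c 1%g (y i))); last first.
  by move=> i iK; rewrite xy//; exact: KJ.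
rewrite -addrA lerD2l.
have ID z := @rsumID _ _ (touching J) (pairs K) _ (pair_coupling_ge0 z)
  (coupling_summable z (@subset_refl _ (pairs K))).
rewrite !ID (@eq_coupling x y (pairs K `&` ~` touching J)); last first.
  by move=> p [_ pJ]; split; apply: xy => Jp; apply: pJ; [left|right].
have : 0 <= rsum (pairs K `&` touching J) (pair_coupling y).
  by apply: rsum_ge0 => p; exact: pair_coupling_ge0.
have : rsum (pairs K `&` touching J) (pair_coupling x) <= pair_mass K J.
  apply: le_rsum => //.
  - by move=> p [[p12 _] _]; exact: pair_coupling_le.
  - by move=> p; exact: pair_coupling_ge0.
  - by move=> p; exact: pair_bound_ge0.
  - exact: (@pairs_summable K).
lra.
Qed.

Lemma pair_mass_tail K (e : R) : 0 < e ->
  exists S, forall L, (S `<=` L)%fset -> pair_mass K (~` [set` L]) <= e.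
Proof.
move=> e0.
have [|X XK hX] := esum_tail e0 _ (pairs_summable (@subset_refl _ (pairs K))).
  by move=> p; rewrite lee_fin pair_bound_ge0.
exists ([fset p.1 | p in X] `|` [fset p.2 | p in X])%fset => L.
rewrite fsubUset => /andP[/fsubsetP X1 /fsubsetP X2].
rewrite -lee_fin rsumE; last 2 first.
- by move=> p; exact: pair_bound_ge0.
- exact: (@pairs_summable K).
apply: le_trans hX; apply: sub_esum => [p [pK pL]|p]; last first.
  by rewrite lee_fin pair_bound_ge0.
split=> // pX; case: pL => /=; apply.
  by apply: X1; apply/imfsetP; exists p.
by apply: X2; apply/imfsetP; exists p.
Qed.

(** A pair meeting [i] has one other site, which cannot lie in both of the disjoint sets. Taking a
    single site [i] gives equality. *)
Lemma pair_massU i J J' : ~ J i -> ~ J' i -> J `&` J' = set0 ->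
  pair_mass [fset i]%fset (J `|` J') =
  pair_mass [fset i]%fset J + pair_mass [fset i]%fset J'.
Proof.
move=> Ji J'i JJ'.
have tU : pairs [fset i]%fset `&` touching (J `|` J') =
  (pairs [fset i]%fset `&` touching J) `|` (pairs [fset i]%fset `&` touching J').
  rewrite -setIUr; congr (_ `&` _); apply/seteqP; split => p /=.
    by case=> -[] h; [left; left|right; left|left; right|right; right].
  by case=> -[] h; [left; left|right; left|left; right|right; right].
rewrite /pair_mass tU rsumU//; last 2 first.
- exact: pair_bound_ge0.
- by apply: (@pairs_summable [fset i]%fset); rewrite -tU.
apply/seteqP; split => // -[g h] [[[/= gh]]]; rewrite !inE.
have J0 k : J k -> J' k -> False.
  by move=> Jk J'k; have : (J `&` J') k by []; rewrite JJ'.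
case=> /eqP ->; rewrite /touching /=.
  by move=> [//|Jh] [_ [//|J'h]]; exact: J0 Jh J'h.
by move=> [Jh|//] [_ [J'h|//]]; exact: J0 Jh J'h.
Qed.

Lemma pair_mass_le i J J' : J `<=` J' ->
  pair_mass [fset i]%fset J <= pair_mass [fset i]%fset J'.
Proof.
move=> JJ'; apply: le_rsum => //.
- by move=> p [pi [/JJ'|/JJ']]; split=> //; [left|right].
- by move=> p; exact: pair_bound_ge0.
- by move=> p; exact: pair_bound_ge0.
- exact: (@pairs_summable [fset i]%fset).
Qed.

Lemma pair_mass_seq i (s : seq G) J : uniq s -> i \notin s -> ~ J i ->
  (forall j, j \in s -> ~ J j) ->
  \sum_(j <- s) pair_mass [fset i]%fset [set j] + pair_mass [fset i]%fset J =
  pair_mass [fset i]%fset ([set` s] `|` J).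
Proof.
elim: s => [|j s ih] /=.
  move=> _ _ _ _; rewrite big_nil add0r (_ : [set` [::]] = set0) ?set0U//.
  by apply/seteqP; split.
move=> /andP[js us]; rewrite inE negb_or => /andP[ij si] Ji sJ.
rewrite big_cons -addrA ih//; last by move=> k ks; apply: sJ; rewrite inE ks orbT.
rewrite -pair_massU.
- congr pair_mass; apply/seteqP; split=> k /=; rewrite inE.
    by case=> [->|[ks|Jk]]; [left; rewrite eqxx|left; rewrite ks orbT|right].
  by case=> [/predU1P[->|ks]|Jk]; [left|right; left|right; right].
- by move=> /= /eqP; rewrite (negPf ij).
- by move=> [/= h|//]; rewrite h in si.
- apply/seteqP; split => // k [/= ->] [/= h|]; first by rewrite h in js.
  by apply: sJ; exact: mem_head.
Qed.

Lemma pair_mass_split i S L : i \in S -> (S `<=` L)%fset ->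
  \sum_(j <- (L `\` S)%fset) pair_mass [fset i]%fset [set j] +
    pair_mass [fset i]%fset (~` [set` L]) <=
  pair_mass [fset i]%fset (~` [set` S]).
Proof.
move=> iS SL; rewrite pair_mass_seq//.
- apply: pair_mass_le => j [/=|jL jS]; first by rewrite inE => /andP[/negP].
  by apply: jL; exact: (fsubsetP SL).
- exact: fset_uniq.
- by rewrite inE iS.
- by apply; exact: (fsubsetP SL).
- by move=> j; rewrite inE => /andP[_ jL]; apply.
Qed.

Lemma pair_mass_row i J : pair_mass [fset i]%fset J <= total_c + total_c.
Proof.
rewrite -lee_fin rsumE; last 2 first.
- by move=> p; exact: pair_bound_ge0.
- exact: (@pairs_summable [fset i]%fset).
rewrite -(esum_pairs1 i); apply: sub_esum => // p.
by rewrite lee_fin pair_bound_ge0.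
Qed.

End pair_energy.

(** * Gibbs weights and their sensitivity *)

Section gibbs_weights.
Variables (R : realType) (G : groupType) (c : G -> nat -> R).
Hypothesis c_ge0 : forall g n, 0 <= c g n.
Hypothesis c_fin : (\esum_(h in [set h | h != 1%g]) sup_c c h < +oo)%E.
Hypothesis c_growth : forall M : R, 0 < M ->
  exists n0 : nat, forall n : nat, (n0 <= n)%N -> M * ln n%:R <= c 1%g n.
Variable beta : R.
Hypothesis beta_gt0 : 0 < beta.
Implicit Types (J : set G) (K L S : {fset G}) (x y : config G).

Definition self_weight n : R := expR (- (beta * c 1%g n)).

Lemma self_weight_ge0 n : 0 <= self_weight n.
Proof. exact: expR_ge0. Qed.

Lemma self_weight_decay : exists n1, (0 < n1)%N /\
  forall n, (n1 <= n)%N -> self_weight n <= (n%:R ^+ 2)^-1.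
Proof.
(* The growth constant [2 / beta] makes the weight at most [n ^ -2]. *)
have [n0 h] := c_growth (divr_gt0 (ltr0Sn R 1) beta_gt0).
exists n0.+1; split=> // n n0n; have n_gt0 : 0 < n%:R :> R.
  by rewrite ltr0n; exact: leq_ltn_trans n0n.
rewrite -[n%:R in leRHS]lnK ?posrE// -expRM_natl -expRN ler_expR lerN2.
apply: le_trans (ler_wpM2l (ltW beta_gt0) (h n (ltnW n0n))).
rewrite (_ : beta * _ = 2 * ln n%:R)//.
by field; rewrite gt_eqF.
Qed.

Lemma summable_self_weight : rsummable [set: nat] self_weight.
Proof.
(* [1 / n ^ 2 <= 2 / n - 2 / (n + 1)], which telescopes *)
have [n1 [n10 h]] := self_weight_decay.
pose D := \sum_(k < n1) self_weight k.
have bound m : \sum_(k < n1 + m) self_weight k <= D + 2 - 2 / (n1 + m)%:R.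
  elim: m => [|m ih].
    rewrite addn0 -addrA lerDl subr_ge0 ler_pdivrMr ?ltr0n//.
    by rewrite ler_peMr// ler1n.
  rewrite addnS big_ord_recr/=.
  have := h (n1 + m)%N (leq_addr _ _); move: ih.
  move: (\sum_(k < _) _) => s; move: (self_weight _) => w.
  rewrite -[(n1 + m).+1%:R]natr1.
  have : 1 <= (n1 + m)%:R :> R by rewrite ler1n addn_gt0 n10.
  move: ((n1 + m)%:R : R) => N N1 hs hw.
  apply: le_trans (lerD hs hw) _.
  have N0 : N != 0 by lra.
  have N10 : N + 1 != 0 by lra.
  rewrite -subr_ge0 [leRHS](_ : _ = (N - 1) / (N ^+ 2 * (N + 1))); last first.
    by field; rewrite N0 N10.
  by rewrite divr_ge0 ?mulr_ge0 ?exprn_ge0//; lra.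
rewrite /rsummable -nneseries_esumT; last first.
  by move=> n; rewrite lee_fin self_weight_ge0.
apply: (@le_lt_trans _ _ (D + 2)%:E); last exact: ltry.
apply: lime_le.
  by apply: is_cvg_nneseries => n _ _; rewrite lee_fin self_weight_ge0.
apply: nearW => N; rewrite big_mkord sumEFin lee_fin.
apply: (@le_trans _ _ (\sum_(k < n1 + N) self_weight k)).
  rewrite -!(big_mkord xpredT self_weight).
  rewrite [leRHS](@big_cat_nat _ _ _ N)//= ?leq_addl//.
  by rewrite lerDl sumr_ge0// => k _; exact: self_weight_ge0.
apply: le_trans (bound N) _; rewrite gerBl divr_ge0//.
Qed.

(** The sum of products factorizes by peeling off one site: the class is the disjoint union, over
    the value at [i], of classes for the remaining sites. *)
Lemma class_sum_le (s : seq G) x : uniq s ->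
  (\esum_(y in [set y | eq_off [set` s] x y])
     (\prod_(i <- s) self_weight (y i))%:E <=
   (rsum [set: nat] self_weight ^+ size s)%:E)%E.
Proof.
set A := rsum _ _; have A0 : 0 <= A by apply: rsum_ge0 => n; exact: self_weight_ge0.
have prod_ge0 (r : seq G) y : 0 <= \prod_(i <- r) self_weight (y i).
  by apply: prodr_ge0 => i _; exact: self_weight_ge0.
elim: s x => [|i s ih] x /=.
  move=> _; rewrite (_ : mkset _ = [set x]).
    by rewrite esum_set1 ?big_nil.
  apply/seteqP; split => [y xy|y ->//]; apply/esym/funext => g; exact: xy.
move=> /andP[is_ us].
pose upd k : config G := fun g => if g == i then k else x g.
rewrite (_ : mkset _ = \bigcup_(k in [set: nat])
    [set y | eq_off [set` s] (upd k) y]); last first.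
  apply/seteqP; split => [y xy|y [k _] xy g gs].
    exists (y i) => // g gs; rewrite /upd; case: eqP => [->//|/eqP gi].
    by apply: xy; rewrite /= inE (negPf gi).
  rewrite -xy; last by move=> gs'; apply: gs; rewrite /= inE gs' orbT.
  by rewrite /upd; case: eqP gs => // ->; rewrite /= mem_head.
rewrite esum_bigcupT; last 2 first.
- move=> k l _ _ [y [yk yl]].
  have ii : ~ [set` s] i by apply/negP.
  by have := yk i ii; have := yl i ii; rewrite /upd eqxx => -> ->.
- by move=> y; rewrite lee_fin prod_ge0.
apply: (@le_trans _ _
    (\esum_(k in [set: nat]) ((A ^+ size s)%:E * (self_weight k)%:E))%E).
  apply: le_esum => k _.
  apply: (@le_trans _ _ ((self_weight k)%:E *
    \esum_(y in [set y | eq_off [set` s] (upd k) y])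
      (\prod_(j <- s) self_weight (y j))%:E)%E).
    rewrite -ge0_esumZl ?self_weight_ge0//; last by move=> y; rewrite lee_fin.
    apply: le_esum => y ky; rewrite big_cons -EFinM.
    have ii : ~ [set` s] i by apply/negP.
    by have := ky i ii; rewrite /upd eqxx => <-.
  by rewrite muleC lee_wpmul2r ?lee_fin ?self_weight_ge0// ih.
rewrite ge0_esumZl ?exprn_ge0//; last first.
  by move=> k; rewrite lee_fin self_weight_ge0.
rewrite -rsumE; [|exact: self_weight_ge0|exact: summable_self_weight].
by rewrite -EFinM exprSr.
Qed.

Definition weight K x : R := expR (- (beta * energy c K x)).

Lemma weight_gt0 K x : 0 < weight K x. Proof. exact: expR_gt0. Qed.

Lemma weight_ge0 K x : 0 <= weight K x. Proof. exact: expR_ge0. Qed.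

(** Dropping the nonnegative pair terms of the energy leaves a product of single-site weights. *)
Lemma summable_weight K x : rsummable (cls K x) (weight K).
Proof.
apply: le_lt_trans (ltry _); apply: le_trans (class_sum_le x (fset_uniq K)).
apply: le_esum => y _; rewrite lee_fin /weight.
rewrite [leRHS](_ : _ = expR (- (beta * \sum_(i <- K) c 1%g (y i)))).
  rewrite ler_expR lerN2 ler_pM2l//; exact: energy_ge_self.
by rewrite mulr_sumr -sumrN expR_sum.
Qed.

Definition gibbs_partition K x : R := rsum (cls K x) (weight K).

Lemma partition_gt0 K x : 0 < gibbs_partition K x.
Proof.
apply: lt_le_trans (weight_gt0 K x) _.
rewrite -lee_fin rsumE; [|exact: weight_ge0|exact: summable_weight].
apply: esum_ge; exists [set x]; last by rewrite fsbig_set1.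
by split; [exact: finite_set1|move=> y ->; exact: cls_refl].
Qed.

Lemma partition_eq K x y : eq_off [set` K] x y ->
  gibbs_partition K x = gibbs_partition K y.
Proof. by move=> xy; rewrite /gibbs_partition (eq_cls xy). Qed.

Definition density K x : R := weight K x / gibbs_partition K x.

Lemma density_ge0 K x : 0 <= density K x.
Proof. by rewrite divr_ge0 ?weight_ge0// ltW// partition_gt0. Qed.

Lemma gam_density K f x : unit_valued f ->
  gam density K f x = rsum (cls K x) (fun y => weight K y * f y) / gibbs_partition K x.
Proof.
move=> f01; have wf0 y : 0 <= weight K y * f y.
  by rewrite mulr_ge0 ?weight_ge0//; have /andP[] := f01 y.
have swf : rsummable (cls K x) (fun y => weight K y * f y).
  apply: rsummable_le (summable_weight K x) => // [y _|y]; last exact: weight_ge0.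
  by rewrite ler_piMr ?weight_ge0//; have /andP[] := f01 y.
rewrite /gam [X in fine X](_ : _ = ((gibbs_partition K x)^-1 *
    rsum (cls K x) (fun y => weight K y * f y))%:E) /=; first by rewrite mulrC.
rewrite EFinM rsumE// -ge0_esumZl.
- apply: eq_esum => y /partition_eq xy; rewrite -EFinM /density xy.
  by rewrite mulrA mulrAC mulrC mulrA.
- by rewrite invr_ge0 ltW// partition_gt0.
- by move=> y; rewrite lee_fin.
Qed.

Lemma density_sum1 K x : (\esum_(y in cls K x) (density K y)%:E = 1)%E.
Proof.
transitivity (\esum_(y in cls K x)
    ((gibbs_partition K x)^-1%:E * (weight K y)%:E))%E.
  by apply: eq_esum => y /partition_eq xy; rewrite -EFinM /density -xy mulrC.
rewrite ge0_esumZl.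
- rewrite -rsumE; [|exact: weight_ge0|exact: summable_weight].
  by rewrite -EFinM mulVf// gt_eqF// partition_gt0.
- by rewrite invr_ge0 ltW// partition_gt0.
- by move=> y; rewrite lee_fin weight_ge0.
Qed.

(** The partition functions depend on the exterior only and are common to both sides, so the
    identity reduces to [energy_diff]. *)
Lemma density_balance K L x y : (K `<=` L)%fset -> eq_off [set` K] x y ->
  density L x * density K y = density L y * density K x.
Proof.
move=> KL xy; rewrite /density.
have xyL : eq_off [set` L] x y.
  by apply: sub_eq_off xy => i /= /(fsubsetP KL).
rewrite -(partition_eq xy) -(partition_eq xyL).
have e := energy_diff c_ge0 c_fin KL xy.
have : weight L x * weight K y = weight L y * weight K x.
  rewrite /weight -!expRD; congr expR.
  have -> : energy c L x = energy c L y + energy c K x - energy c K y by lra.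
  ring.
by rewrite !mulf_div => ->.
Qed.

Definition influence K J : R := 2 * beta * pair_mass c K J.

Lemma influence_ge0 K J : 0 <= influence K J.
Proof. by rewrite !mulr_ge0 ?pair_mass_ge0// ltW. Qed.

Lemma weight_sensitivity K J x y : (forall i, i \in K -> ~ J i) ->
  eq_off J x y -> weight K x <= expR (beta * pair_mass c K J) * weight K y.
Proof.
move=> KJ xy; rewrite /weight -expRD ler_expR.
have := energy_sensitivity c_ge0 c_fin KJ (eq_off_sym xy).
by rewrite -(ler_pM2l beta_gt0) mulrDr; lra.
Qed.

Lemma partition_sensitivity K J x y : (forall i, i \in K -> ~ J i) ->
  eq_off J x y ->
  gibbs_partition K x <= expR (beta * pair_mass c K J) * gibbs_partition K y.
Proof.
move=> KJ xy; rewrite -lee_fin EFinM !rsumE; [|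
  exact: weight_ge0|exact: summable_weight|exact: weight_ge0|exact: summable_weight].
rewrite (reindex_esum _ _ _ _ (overlay_bij K x y)) -ge0_esumZl ?expR_ge0//.
  apply: le_esum => z yz; rewrite -EFinM lee_fin.
  apply: weight_sensitivity => //.
  by apply/eq_off_sym/(eq_off_overlay xy yz).
by move=> z; rewrite lee_fin weight_ge0.
Qed.

(** With [s = beta * pair_mass c K J], the weight and the partition function each change by a factor
    at most [expR s]; the density keeps at least the factor [expR (- (s + s))], which is at least
    [1 - 2 * s]. Hence the 2 in [influence]. *)
Lemma density_sensitivity K J x y : (forall i, i \in K -> ~ J i) ->
  eq_off J x y -> (1 - influence K J) * density K y <= density K x.
Proof.
move=> KJ xy.
have Zx := partition_gt0 K x; have Zy := partition_gt0 K y.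
have hw := weight_sensitivity KJ (eq_off_sym xy).
have hZ := partition_sensitivity KJ xy.
set s := beta * _ in hw hZ.
apply: (@le_trans _ _ (expR (- (s + s)) * density K y)).
  rewrite ler_wpM2r ?density_ge0//; apply: le_trans (expR_ge1Dx _).
  rewrite /influence -mulrA -/s; lra.
rewrite opprD expRD.
have es := expR_ge0 (- s).
have e1 : expR (- s) * expR s = 1 by rewrite -expRD addNr expR0.
have h1 : expR (- s) * weight K y <= weight K x.
  apply: le_trans (ler_wpM2l es hw) _; by rewrite mulrA e1 mul1r.
have h2 : expR (- s) * gibbs_partition K x <= gibbs_partition K y.
  apply: le_trans (ler_wpM2l es hZ) _; by rewrite mulrA e1 mul1r.
rewrite /density ler_pdivlMr// [leLHS](_ : _ =
  (expR (- s) * weight K y) * (expR (- s) * gibbs_partition K x) / gibbs_partition K y).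
  rewrite ler_pdivrMr//.
  by apply: ler_pM => //; rewrite mulr_ge0// ?weight_ge0// ltW.
by field; rewrite gt_eqF.
Qed.

Lemma influence_tail K (e : R) : 0 < e ->
  exists S, forall L, (S `<=` L)%fset -> influence K (~` [set` L]) <= e.
Proof.
move=> e0; have b2 : 0 < 2 * beta by rewrite mulr_gt0.
have [S hS] := pair_mass_tail c_ge0 c_fin K (divr_gt0 e0 b2).
by exists S => L /hS; rewrite ler_pdivlMr// mulrC.
Qed.

Lemma influence_split i S L : i \in S -> (S `<=` L)%fset ->
  \sum_(j <- (L `\` S)%fset) influence [fset i]%fset [set j] +
    influence [fset i]%fset (~` [set` L]) <=
  influence [fset i]%fset (~` [set` S]).
Proof.
move=> iS SL; rewrite /influence -mulr_sumr -mulrDr ler_pM2l ?mulr_gt0//.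
exact: pair_mass_split.
Qed.

Lemma influence_row i J : influence [fset i]%fset J <= 4 * beta * total_c c.
Proof.
rewrite /influence (_ : 4 * beta * _ = 2 * beta * (total_c c + total_c c)); last ring.
by rewrite ler_pM2l ?mulr_gt0//; exact: pair_mass_row.
Qed.

End gibbs_weights.

(** * The Gibbs kernels *)

(** The two ratios lie in [0, 1] and each is at most [k] times the other. *)
Lemma ratio_close (R : realFieldType) (A Z A' Z' k : R) :
  0 < Z -> 0 < Z' -> 0 <= A -> A <= Z -> A' <= Z' -> 1 <= k ->
  A <= A' <= k * A -> Z <= Z' <= k * Z -> `|A' / Z' - A / Z| <= k - 1.
Proof.
move=> Z0 Z'0 A0 AZ AZ' k1 /andP[AA' A'A] /andP[ZZ' Z'Z].
have k0 : 0 <= k by lra.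
have A'0 : 0 <= A' by lra.
have g0 : 0 <= A / Z by rewrite divr_ge0// ltW.
have g1 : A / Z <= 1 by rewrite ler_pdivrMr// mul1r.
have r0 : 0 <= A' / Z' by rewrite divr_ge0// ltW.
have r1 : A' / Z' <= 1 by rewrite ler_pdivrMr// mul1r.
have rg : A' / Z' <= k * (A / Z).
  rewrite ler_pdivrMr// [leRHS](_ : _ = k * A * Z' / Z).
    rewrite ler_pdivlMr//; apply: ler_pM => //; exact: ltW.
  by field; rewrite gt_eqF.
have gr : A / Z <= k * (A' / Z').
  rewrite ler_pdivrMr// [leRHS](_ : _ = A' * (k * Z) / Z').
    rewrite ler_pdivlMr//; apply: ler_pM => //; exact: ltW.
  by field; rewrite gt_eqF.
have h1 : (k - 1) * (A / Z) <= k - 1 by rewrite ler_piMr// subr_ge0.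
have h2 : (k - 1) * (A' / Z') <= k - 1 by rewrite ler_piMr// subr_ge0.
rewrite ler_norml; lra.
Qed.

Section gibbs_limit.
Variables (R : realType) (G : groupType) (c : G -> nat -> R).
Hypothesis c_ge0 : forall g n, 0 <= c g n.
Hypothesis c_fin : (\esum_(h in [set h | h != 1%g]) sup_c c h < +oo)%E.
Hypothesis c_growth : forall M : R, 0 < M ->
  exists n0 : nat, forall n : nat, (n0 <= n)%N -> M * ln n%:R <= c 1%g n.
Variable beta : R.
Hypothesis beta_gt0 : 0 < beta.
Implicit Types (K L S : {fset G}) (x y : config G).

Definition rows (A : set G) : set (G * G) := [set p | p.1 != p.2 /\ A p.1].

Lemma rows_pairs L : rows [set` L] `<=` pairs L.
Proof. by move=> p [p12 pL]; split=> //; left. Qed.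

(** As [act_config i x h] is [x (h * i)], the potential at the shifted configuration reads exactly
    the pairs [(i, h * i)], that is, those with first site [i]. *)
Lemma phi_act x (i : G) : phi c (act_config i x) =
  - (c 1%g (x i) + rsum (rows [set i]) (pair_coupling c x)).
Proof.
rewrite /phi; congr (- _).
have row_sub : rows [set i] `<=` pairs [fset i]%fset.
  by move=> p [p12 /= pi]; split=> //; left; rewrite inE pi.
have term_ge0 g : (0 <= (c g (act_config i x 1%g) *
    (act_config i x 1%g == act_config i x g)%:R)%:E)%E.
  by rewrite lee_fin mulr_ge0.
rewrite (_ : [set: G] = [set 1%g] `|` [set h | h != 1%g]); last first.
  by apply/seteqP; split=> // h _; case: (eqVneq h 1%g) => [->|]; [left|right].
rewrite esumU//; last first.
  by apply/seteqP; split => // h [/= ->]; rewrite eqxx.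
rewrite esum_set1// eqxx mulr1 /act_config mul1g.
have -> : (\esum_(g in [set h | h != 1%g]) (c g (x i) * (x i == x (g * i)%g)%:R)%:E
    = (rsum (rows [set i]) (pair_coupling c x))%:E)%E.
  rewrite rsumE; last 2 first.
  - by move=> p; exact: pair_coupling_ge0.
  - exact: (coupling_summable c_ge0 c_fin x row_sub).
  rewrite (reindex_esum [set h | h != 1%g] _ (fun h => (i, (h * i)%g))).
    by apply: eq_esum => h _; rewrite /pair_coupling /= mulgK.
  split=> [h /= h1|h k _ _ [/mulIg]//|[j k] /= [jk ji]].
    by split=> //=; apply: contra_neq h1 => hi; apply: (mulIg i); rewrite mul1g.
  rewrite /= in jk ji; rewrite ji in jk *.
  exists (k * i^-1)%g; first exact: (@pair_ratio_neq1 _ (i, k)).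
  by rewrite mulgVK.
by rewrite -EFinD.
Qed.

Lemma psi_sumE L x : psi_sum (fun z => beta * phi c z) L x =
  - (beta * (\sum_(i <- L) c 1%g (x i) + rsum (rows [set` L]) (pair_coupling c x))).
Proof.
rewrite /psi_sum -mulr_sumr -mulrN; congr (_ * _).
under eq_bigr do rewrite phi_act; rewrite sumrN big_split/=; congr (- (_ + _)).
have u0 p : 0 <= pair_coupling c x p by exact: pair_coupling_ge0.
suff H (s : seq G) : uniq s -> {subset s <= L} ->
    \sum_(i <- s) rsum (rows [set i]) (pair_coupling c x) =
    rsum (rows [set` s]) (pair_coupling c x).
  by rewrite H//; exact: fset_uniq.
elim: s => [_ _|i s ih /= /andP[is_ us] sL].
  rewrite big_nil /rsum (_ : rows _ = set0) ?esum_set0//.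
  by apply/seteqP; split => // p [].
rewrite big_cons ih//; last by move=> j js; apply: sL; rewrite inE js orbT.
rewrite -rsumU//.
- congr rsum; apply/seteqP; split => p.
    case=> -[p12 /= ps]; split=> //=; rewrite inE ?ps ?eqxx ?orbT//.
  by case=> p12 /=; rewrite inE => /predU1P[]; [left|right].
- apply/seteqP; split => // p [[_ /= pi] [_ /= ps]].
  by rewrite pi (negPf is_) in ps.
- apply: (coupling_summable c_ge0 c_fin x (K := L)) => p [] [p12 /= pi]; split => //; left.
    by rewrite pi; apply: sL; exact: mem_head.
  by apply: sL; rewrite inE pi orbT.
Qed.

(* The part of the energy of [K] that is seen by the potential summed over [L]:
   the pairs whose first site lies outside [L] are missing. *)
Definition cut_energy L K x : R := \sum_(i <- K) c 1%g (x i) +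
  rsum (pairs K `&` rows [set` L]) (pair_coupling c x).

Lemma cut_energy_le L K x : cut_energy L K x <= energy c K x.
Proof.
rewrite lerD2l; apply: le_rsum => //.
- by move=> p; exact: pair_coupling_ge0.
- by move=> p; exact: pair_coupling_ge0.
- exact: (coupling_summable c_ge0 c_fin x (@subset_refl _ (pairs K))).
Qed.

(** A missing pair has its first site outside [L], so the deficit is a tail of the pair mass, small
    for large [L]. *)
Lemma energy_le_cut L K x :
  energy c K x <= cut_energy L K x + pair_mass c K (~` [set` L]).
Proof.
rewrite /energy /cut_energy -addrA lerD2l.
rewrite (@rsumID _ _ (rows [set` L]) (pairs K)); last 2 first.
- by move=> p; exact: pair_coupling_ge0.
- exact: (coupling_summable c_ge0 c_fin x (@subset_refl _ (pairs K))).
rewrite lerD2l; apply: le_rsum.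
- by move=> p [pK pL]; split=> //; left=> /= pL'; apply: pL; case: pK => p12 _; split.
- by move=> p [[p12 _] _]; exact: pair_coupling_le.
- by move=> p; exact: pair_coupling_ge0.
- by move=> p; exact: cmax_ge0.
- exact: (@pairs_summable _ _ c c_ge0 c_fin K _ (@subIsetl _ _ _)).
Qed.

Lemma psi_sum_cut L K x y : (K `<=` L)%fset -> eq_off [set` K] x y ->
  psi_sum (fun z => beta * phi c z) L y =
  psi_sum (fun z => beta * phi c z) L x + beta * cut_energy L K x
  - beta * cut_energy L K y.
Proof.
move=> KL xy; rewrite !psi_sumE /cut_energy.
have rowE z : rsum (rows [set` L]) (pair_coupling c z) =
    rsum (pairs K `&` rows [set` L]) (pair_coupling c z) +
    rsum (rows [set` L] `&` ~` pairs K) (pair_coupling c z).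
  rewrite (@rsumID _ _ (pairs K)) 1?setIC//.
    by move=> p; exact: pair_coupling_ge0.
  exact: (coupling_summable c_ge0 c_fin z (@rows_pairs L)).
rewrite !(sum_fset_split _ KL) !rowE.
rewrite (@eq_coupling _ _ _ y x (rows [set` L] `&` ~` pairs K)); last first.
  move=> p [[p12 _] pK]; split; apply/esym/xy => /= pk; apply: pK; split => //.
    by left.
  by right.
rewrite (eq_big_seq (fun i => c 1%g (x i))
   (r := enum_fset (L `\` K)%fset)); first by ring.
by move=> i; rewrite inE => /andP[iK _]; rewrite xy//; exact/negP.
Qed.

Let cut_weight L K x : R := expR (- (beta * cut_energy L K x)).

Lemma weight_le_cut L K x : weight c beta K x <= cut_weight L K x.
Proof. by rewrite ler_expR lerN2 ler_pM2l// cut_energy_le. Qed.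

Lemma cut_weight_le L K x : cut_weight L K x <=
  expR (beta * pair_mass c K (~` [set` L])) * weight c beta K x.
Proof.
rewrite /weight /cut_weight -expRD ler_expR.
have := energy_le_cut L K x; rewrite -(ler_pM2l beta_gt0) mulrDr; lra.
Qed.

Lemma finite_gibbsE L K (B : set (config G)) x : (K `<=` L)%fset ->
  exists2 r : R,
    ((\esum_(w in [set: {ffun K -> nat}])
      (expR (psi_sum (fun z => beta * phi c z) L (splice w x)) *
        \1_B (splice w x))%:E) /
     (\esum_(v in [set: {ffun K -> nat}])
      (expR (psi_sum (fun z => beta * phi c z) L (splice v x)))%:E) = r%:E)%E &
    `|r - gam (density c beta) K \1_B x| <=
      expR (beta * pair_mass c K (~` [set` L])) - 1.
Proof.
move=> KL; set t := beta * pair_mass _ _ _.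
have t0 : 0 <= t by rewrite mulr_ge0 ?pair_mass_ge0// ltW.
(* The part of the exponent that is constant on the class; [expR D] cancels in the quotient. *)
pose D := psi_sum (fun z => beta * phi c z) L x + beta * cut_energy L K x.
have B01 : unit_valued (\1_B : config G -> R).
  by move=> y; rewrite indicE ler0n lern1 leq_b1.
have B0 y : 0 <= (\1_B y : R) by have /andP[] := B01 y.
have B1 y : (\1_B y : R) <= 1 by have /andP[] := B01 y.
have psiE y : cls K x y ->
    expR (psi_sum (fun z => beta * phi c z) L y) = expR D * cut_weight L K y.
  by move=> /(psi_sum_cut KL) ->; rewrite -expRD.
have cw0 y : 0 <= cut_weight L K y by exact: expR_ge0.
have w0 y : 0 <= weight c beta K y by exact: expR_ge0.
have sW := summable_weight c_ge0 c_growth beta_gt0 K x.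
have stW : rsummable (cls K x) (fun y => expR t * weight c beta K y).
  rewrite /rsummable; under eq_esum do rewrite EFinM.
  rewrite ge0_esumZl ?expR_ge0//.
  by rewrite -(rsumE w0 sW) -EFinM ltry.
have sV : rsummable (cls K x) (cut_weight L K).
  apply: (rsummable_le _ _ _ stW) => // [y _|y]; first exact: cut_weight_le.
  by rewrite mulr_ge0 ?expR_ge0.
have sVB : rsummable (cls K x) (fun y => cut_weight L K y * \1_B y).
  by apply: (rsummable_le _ _ _ sV) => // y _; rewrite ler_piMr.
have sWB : rsummable (cls K x) (fun y => weight c beta K y * \1_B y).
  by apply: (rsummable_le _ _ _ sW) => // y _; rewrite ler_piMr.
have VB0 y : 0 <= cut_weight L K y * \1_B y by rewrite mulr_ge0.
have WB0 y : 0 <= weight c beta K y * \1_B y by rewrite mulr_ge0.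
have rsum_scale (v w : config G -> R) : (forall y, 0 <= v y) ->
    (forall y, 0 <= w y) -> rsummable (cls K x) v -> rsummable (cls K x) w ->
    (forall y, v y <= expR t * w y) ->
    rsum (cls K x) v <= expR t * rsum (cls K x) w.
  move=> v0 w0' sv sw vw; rewrite -lee_fin EFinM !rsumE//.
  rewrite -ge0_esumZl ?expR_ge0//.
  by apply: le_esum => y _; rewrite -EFinM lee_fin.
set N1 := rsum (cls K x) (fun y => cut_weight L K y * \1_B y).
set Z1 := rsum (cls K x) (cut_weight L K).
have Zpos := partition_gt0 c_ge0 c_growth beta_gt0 K x.
have ZZ1 : gibbs_partition c beta K x <= Z1.
  by apply: le_rsum => // y _; exact: weight_le_cut.
have Z1Z : Z1 <= expR t * gibbs_partition c beta K x.
  by apply: rsum_scale => // y; exact: cut_weight_le.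
set A := rsum (cls K x) (fun y => weight c beta K y * \1_B y).
have AN : A <= N1.
  by apply: le_rsum => // y _; rewrite ler_wpM2r//; exact: weight_le_cut.
have NA : N1 <= expR t * A.
  apply: rsum_scale => // y; rewrite mulrA ler_wpM2r//; exact: cut_weight_le.
have AZ : A <= gibbs_partition c beta K x.
  by apply: le_rsum => // y _; rewrite ler_piMr.
have A0 : 0 <= A by apply: rsum_ge0.
have Z1pos : 0 < Z1 by apply: lt_le_trans ZZ1.
have N1Z1 : N1 <= Z1.
  by apply: le_rsum => // y _; rewrite ler_piMr.
have N10 : 0 <= N1 by apply: rsum_ge0.
exists (N1 / Z1).
  have numE : \esum_(w in [set: {ffun K -> nat}])
      (expR (psi_sum (fun z => beta * phi c z) L (splice w x)) *
        \1_B (splice w x))%:E = (expR D * N1)%:E.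
    rewrite -(reindex_esum _ _ _ (fun y => (expR (psi_sum
      (fun z => beta * phi c z) L y) * \1_B y)%:E) (splice_bij K x)).
    rewrite EFinM rsumE// -ge0_esumZl ?expR_ge0//.
    by apply: eq_esum => y /psiE ->; rewrite -EFinM mulrA.
  have denE : \esum_(w in [set: {ffun K -> nat}])
      (expR (psi_sum (fun z => beta * phi c z) L (splice w x)))%:E =
      (expR D * Z1)%:E.
    rewrite -(reindex_esum _ _ _ (fun y => (expR (psi_sum
      (fun z => beta * phi c z) L y))%:E) (splice_bij K x)).
    rewrite EFinM rsumE// -ge0_esumZl ?expR_ge0//.
    by apply: eq_esum => y /psiE ->; rewrite -EFinM.
  rewrite numE denE inver gt_eqF ?mulr_gt0 ?expR_gt0//.
  by rewrite -EFinM -mulf_div mulfV ?mul1r// gt_eqF ?expR_gt0.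
rewrite (gam_density c_ge0 c_growth beta_gt0 K x B01) -/A.
have e1 : 1 <= expR t by rewrite -expR0 ler_expR.
have hA : A <= N1 <= expR t * A by rewrite AN.
have hZ : gibbs_partition c beta K x <= Z1 <=
    expR t * gibbs_partition c beta K x by rewrite ZZ1.
exact: (ratio_close Zpos Z1pos A0 AZ N1Z1 e1 hA hZ).
Qed.

Variable E : nat -> {fset G}.
Hypothesis E_mono : forall m n, (m <= n)%N -> (E m `<=` E n)%fset.
Hypothesis E_cover : forall S, exists n, (S `<=` E n)%fset.

Theorem gibbs_gam K (B : set (config G)) x :
  gibbs E (fun z => beta * phi c z) K B x =
  (gam (density c beta) K \1_B x)%:E.
Proof.
have [n0 Kn0] := E_cover K.
apply: cvg_lim => //; apply/fine_cvgP; split.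
  exists n0 => // n /= n0n.
  by have [r -> _] := finite_gibbsE B x (fsubset_trans Kn0 (E_mono n0n)).
apply/cvgrPdist_le => e e0.
(* Chosen so that [expR (beta * pair_mass) - 1 <= e] once the pair mass is below it. *)
have le0 : 0 < ln (1 + e) / beta by rewrite divr_gt0// ln_gt0//; lra.
have [S hS] := pair_mass_tail c_ge0 c_fin K le0.
have [n1 Sn1] := E_cover S.
exists (maxn n0 n1) => // n /=; rewrite geq_max => /andP[n0n n1n].
have [r /= -> rg] := finite_gibbsE B x (fsubset_trans Kn0 (E_mono n0n)).
rewrite distrC; apply: le_trans rg _ => /=.
rewrite lerBlDl -[leRHS]lnK ?posrE; last by lra.
rewrite ler_expR mulrC -ler_pdivlMr//.
exact: hS (fsubset_trans Sn1 (E_mono n1n)).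
Qed.

End gibbs_limit.

(** * Exhausting sequences *)

Section exhausting_theory.
Variables (G : groupType) (E : nat -> {fset G}).
Hypothesis E_exhausting : exhausting E.

Lemma exhausting_mono m n : (m <= n)%N -> (E m `<=` E n)%fset.
Proof.
have [_ _ EE _] := E_exhausting; elim: n => [|n ih].
  by rewrite leqn0 => /eqP ->.
rewrite leq_eqVlt => /predU1P[-> //|/ih mn].
by apply: fsubset_trans mn (fproper_sub (EE n)).
Qed.

Lemma exhausting_cover (S : {fset G}) : exists n, (S `<=` E n)%fset.
Proof.
have [_ _ _ Ecov] := E_exhausting; have [f hf] := choice Ecov.
exists (\max_(g <- S) f g); apply/fsubsetP => g gS.
by apply: (fsubsetP (exhausting_mono _) _ (hf g)); exact: leq_bigmax_seq.
Qed.

Lemma exhausting_card n : (n <= #|` E n|)%N.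
Proof.
have [_ _ EE _] := E_exhausting; elim: n => // n ih.
exact: leq_ltn_trans ih (fproper_ltn_card (EE n)).
Qed.

(** Strict growth of the sets forces the group to be infinite, so a countable one is in bijection
    with the naturals. *)
Lemma exhausting_enumeration : countable [set: G] ->
  exists (site : nat -> G) (idx : G -> nat), cancel idx site /\ cancel site idx.
Proof.
move=> Gc; have Ginf : infinite_set [set: G].
  move=> Gfin; have := exhausting_card #|` fset_set [set: G]|.+1.
  rewrite leqNgt => /negP; apply; rewrite ltnS; apply: fsubset_leq_card.
  by apply/fsubsetP => g _; rewrite in_fset_set// inE.
have /pcard_eqP[f] := eq_card_nat Gc Ginf.
have fsurj n : exists g, f g = n.
  by have [g _ gn] := @surj _ _ _ _ f n I; exists g.
have [site fsite] := choice fsurj.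
exists site, f; split=> // g; apply: (@inj _ _ _ f); rewrite ?inE//; exact: fsite.
Qed.

End exhausting_theory.

Theorem mainTheorem10 (R : realType) (G : groupType)
    (G_countable : countable [set: G]) (G_amenable : amenable R G)
    (E : nat -> {fset G}) (E_exhausting : exhausting E)
    (c : G -> nat -> R) (c_ge0 : forall g n, 0 <= c g n)
    (c_summable :
      (\sum_(1 <= m <oo) (#|` (E m.+1 `\` E m)%fset|%:R%:E *
         \esum_(g in ~` [set` E m]) sup_c c g) < +oo)%E)
    (c_growth : forall M : R, 0 < M ->
      exists n0 : nat, forall n : nat, (n0 <= n)%N ->
        M * ln n%:R <= c 1%g n)
    (beta : R) (beta_gt0 : 0 < beta)
    (beta_small :
      (beta%:E < (4%:E * \esum_(h in [set h | h != 1%g]) sup_c c h)^-1)%E) :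
  exists mu : probability (borel_config G) R,
    is_DLR E (fun x => beta * phi c x) mu /\
    (forall nu : probability (borel_config G) R,
       is_DLR E (fun x => beta * phi c x) nu ->
       forall B : set (borel_config G), measurable B -> nu B = mu B).
Proof.
(* An infinite sum would have inverse 0, leaving no room for a positive [beta]. *)
have c_fin : (\esum_(h in [set h | h != 1%g]) sup_c c h < +oo)%E.
  rewrite ltNge leye_eq; apply/negP => /eqP Soo; move: beta_small.
  by rewrite Soo mulry gtr0_sg ?mul1e ?invey// lte_fin ltNge ltW.
have row_lt1 : 4 * beta * total_c c < 1.
  have totE : (total_c c)%:E = \esum_(h in [set h | h != 1%g]) sup_c c h.
    rewrite rsumE; [|exact: cmax_ge0|exact: summable_cmax].
    by apply: eq_esum => h; exact: cmaxE.
  have : 0 <= total_c c by apply: rsum_ge0; exact: cmax_ge0.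
  move: beta_small; rewrite -totE -EFinM inver; move: (total_c c) => s.
  (* A zero sum has inverse [+oo], the convention for 1/0; then the row sum is 0 for every
     [beta]. *)
  case: eqVneq => [s0 _ _|s0].
    by rewrite -mulrA mulrCA s0 mulr0 ltr01.
  rewrite lte_fin => bs s_ge0; have s4 : 0 < 4 * s.
    by rewrite lt_neqAle eq_sym s0 mulr_ge0.
  by move: bs; rewrite -[_^-1]mul1r ltr_pdivlMr//; lra.
have E_mono := exhausting_mono E_exhausting.
have E_cover := exhausting_cover E_exhausting.
have [site [idx [siteK idxK]]] := exhausting_enumeration E_exhausting G_countable.
have q_ge0 := density_ge0 c_ge0 c_growth beta_gt0.
have q_sum1 := density_sum1 c_ge0 c_growth beta_gt0.
have q_bal := density_balance c_ge0 c_fin beta.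
have q_sens := density_sensitivity c_ge0 c_fin c_growth beta_gt0.
have th_ge0 := influence_ge0 c_ge0 beta_gt0.
have th_tail := influence_tail c_ge0 c_fin beta_gt0.
have decay := gam_boundary_decay q_ge0 q_sum1 q_bal th_ge0 q_sens
  (influence_split c_ge0 c_fin beta_gt0) row_lt1
  (fun i => influence_row c_ge0 c_fin beta_gt0 i _) th_tail.
have [mu mu_Cyl] := exists_limit_measure q_ge0 q_sum1 q_bal decay E_mono E_cover
  siteK idxK.
have gibbsE := gibbs_gam c_ge0 c_fin c_growth beta_gt0 E_mono E_cover.
exists mu; split=> [K B K0 mB|nu nuDLR].
  exists (fun x => (gam (density c beta) K \1_B x)%:E).
    exact: (gam_cond_prob q_ge0 q_sum1 q_bal th_ge0 q_sens th_tail decay E_mono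
      E_cover siteK mu_Cyl).
  by apply: aeW => x; rewrite gibbsE.
apply: (limit_measure_unique q_ge0 q_sum1 q_bal th_ge0 q_sens th_tail decay
  E_mono E_cover siteK mu_Cyl) => K B K0 mB.
have [f fB fae] := nuDLR K B K0 mB; exists f => //.
case: fae => A [mA A0 fA]; exists A; split => // x /= fx.
by apply: fA => /= fx'; apply: fx; rewrite fx' gibbsE.
Qed.
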